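(* For a positive integer $n$, let $\bar{S}(n)$ denote the number of integers $x$ with $1\le x\le n$ such that $x!$ cannot be written as a sum of three squares of integers. Then for every integer $k\ge 2$, $$ \bar{S}(2^k) = \begin{cases} 2^{k-3} - 2^{(k-4)/2}, & \text{if } k \equiv 0, 2, 22 \pmod{24},\\ 2^{k-3} - 2^{(k-3)/2}, & \text{if } k \equiv 1, 3 \pmod{24},\\ 2^{k-3} - 2^{(k-5)/2}, & \text{if } k \equiv 11 \pmod{24},\\ 2^{k-3} + 2^{(k-4)/2}, & \text{if } k \equiv 14, 16, 18 \pmod{24},\\ 2^{k-3} + 2^{(k-3)/2}, & \text{if } k \equiv 17 \pmod{24},\\ 2^{k-3} - 3\cdot 2^{(k-5)/2}, & \text{if } k \equiv 23 \pmod{24},\\ 2^{k-3}, & \text{otherwise.} \end{cases} $$ *)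

(* Defs.v *)
From mathcomp Require Import all_boot all_order all_algebra.
From mathcomp Require Import boolp.

Set Implicit Arguments.
Unset Strict Implicit.
Unset Printing Implicit Defensive.

Import GRing.Theory Num.Theory.
Local Open Scope ring_scope.

Definition sum_of_three_squares (m : int) : Prop :=
  exists a b c : int, m = a ^+ 2 + b ^+ 2 + c ^+ 2.

Definition Sbar (n : nat) : nat :=
  #|[set x : 'I_n.+1 | (1 <= x)%N && `[< ~ sum_of_three_squares (x`!)%:Z >]]|.

(* Main.v *)
(* [x!] fails to be a sum of three squares iff its 2-adic valuation is even and
   its odd part is 7 modulo 8 (Legendre). These two data of [x!], together with
   [x] modulo 4, are computed by a 32-state automaton reading the binary digits
   of [x], and counting accepted words is a linear recurrence of period 24 up to
   the factor [2 ^ 12].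

   Legendre's theorem is proved without Dirichlet's theorem. If [- e] is a square
   modulo [d] and [- d] is a square modulo [e], then [d] is a value of an
   integral positive ternary form of determinant 1, which Gauss reduction turns
   into [x^2 + y^2 + z^2]. A suitable [e] is a product of primes [p] with
   [(-d / p) = 1] in a prescribed class modulo squares; it exists because two
   nontrivial real characters [psi], [phi] modulo [N] always take the value [-1]
   at a common prime: otherwise [psi * phi] (Dirichlet convolution) is
   nonnegative and at least 1 on squares prime to [N], so that its sum against
   [n^(-1/2)] diverges, while the hyperbola method shows that it is bounded. *)

From Stdlib Require Import NArith.
Require Import Defs.
From mathcomp Require Import all_boot all_order all_algebra.
From mathcomp Require Import all_fingroup all_solvable all_field.
From mathcomp Require Import boolp.
From mathcomp Require Import zify ring lra.

Import Order.TTheory GRing.Theory Num.Theory.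
Local Open Scope ring_scope.

Set Implicit Arguments.
Unset Strict Implicit.
Unset Printing Implicit Defensive.

(** * Ternary forms of determinant 1 *)

Lemma centered_remainder (A B : int) : 0 < A ->
  exists k, - A <= 2 * (B + k * A) <= A.
Proof.
move=> A0; exists (- ((2 * B + A) %/ (2 * A))%Z).
have A2 : 2 * A != 0 by lia.
have := divz_eq (2 * B + A) (2 * A).
have := modz_ge0 (2 * B + A) A2.
have : ((2 * B + A) %% (2 * A))%Z < 2 * A by apply: ltz_pmod; lia.
nia.
Qed.

(** The ternary form of the symmetric matrix with rows [(A, B, u)], [(B, C, w)], [(u, w, D)]. *)
Definition tform (A B C u w D x y z : int) : int :=
  A * x ^+ 2 + C * y ^+ 2 + D * z ^+ 2 +
  2 * (B * x * y + u * x * z + w * y * z).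

Lemma tform_shift12 k A B C u w D x y z :
  tform A B C u w D x y z =
  tform A (B + k * A) (C + 2 * k * B + k ^+ 2 * A) u (w + k * u) D
    (x - k * y) y z.
Proof. rewrite /tform; ring. Qed.

Lemma tform_shift23 k A B C u w D x y z :
  tform A B C u w D x y z =
  tform A B C (u + k * B) (w + k * C) (D + 2 * k * w + k ^+ 2 * C)
    x (y - k * z) z.
Proof. rewrite /tform; ring. Qed.

Lemma tform_swap12 A B C u w D x y z :
  tform A B C u w D x y z = tform C B A w u D y x z.
Proof. rewrite /tform; ring. Qed.

Lemma tform_swap23 A B C u w D x y z :
  tform A B C u w D x y z = tform A u D B w C x z y.
Proof. rewrite /tform; ring. Qed.

Lemma reduced_binary_det (p q r : int) :
  0 < p -> - p <= 2 * q <= p -> p <= r -> 3 * p ^+ 2 <= 4 * (p * r - q ^+ 2).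
Proof. by move=> p0 /andP[h1 h2] h3; rewrite !expr2; nia. Qed.

(** The larger of the two, say [p], satisfies [3 p^2 <= 4 A <= 4 p], hence [p <= 4/3]. *)
Lemma reduced_binary_bounds (A p : int) : 0 < A -> 0 < p ->
  3 * A ^+ 2 <= 4 * p -> 3 * p ^+ 2 <= 4 * A -> A = 1 /\ p = 1.
Proof.
move=> A0 p0 h1 h2.
have [h|h] : A <= p \/ p <= A by lia.
  have : p <= 1 by rewrite expr2 in h2; nia.
  lia.
have : A <= 1 by rewrite expr2 in h1; nia.
lia.
Qed.

(* Here [p], [q], [r] are the coefficients of the binary form
   [A * Q - (A x + B y + u z)^2], whose determinant is [A] times that of [Q].
   Both swaps keep one of [A] and [p] and lower the other. *)
Lemma tform_det1_sum3sq (A B C u w D x y z : int) :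
  0 < A -> 0 < A * C - B ^+ 2 ->
  (A * C - B ^+ 2) * (A * D - u ^+ 2) - (A * w - B * u) ^+ 2 = A ->
  sum_of_three_squares (tform A B C u w D x y z).
Proof.
have [n] := ubnP (absz (A + (A * C - B ^+ 2))).
elim: n A B C u w D x y z => // n IH A B C u w D x y z ltn A0 p0 det1.
have [k hk] := centered_remainder B A0.
rewrite (tform_shift12 k).
set B1 := B + k * A in hk *.
set C1 := C + _ + _; set w1 := w + _; set x1 := x - _.
have p1E : A * C1 - B1 ^+ 2 = A * C - B ^+ 2 by rewrite /C1 /B1; ring.
have q1E : A * w1 - B1 * u = A * w - B * u by rewrite /w1 /B1; ring.
rewrite -p1E -q1E in ltn p0 det1.
clear p1E q1E; move: B1 C1 w1 x1 hk ltn p0 det1; clear B C w x k.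
move=> B C w x hB ltn p0 det1.
have [m hq] := centered_remainder (A * w - B * u) p0.
rewrite (tform_shift23 m).
set u1 := u + _; set w1 := w + _; set D1 := D + _ + _; set y1 := y - _.
have qE : A * w1 - B * u1 = A * w - B * u + m * (A * C - B ^+ 2)
  by rewrite /w1 /u1; ring.
rewrite -qE in hq.
have det1' : (A * C - B ^+ 2) * (A * D1 - u1 ^+ 2) - (A * w1 - B * u1) ^+ 2 = A.
  by rewrite -[RHS]det1 /w1 /u1 /D1; ring.
clear qE det1; move: u1 w1 D1 y1 hq det1'; clear u w D y m.
move=> u w D y hq det1.
have [ltCA|leAC] : C < A \/ A <= C by lia.
  rewrite tform_swap12.
  have pE : C * A - B ^+ 2 = A * C - B ^+ 2 by ring.
  have C0 : 0 < C by rewrite expr2 in p0; nia.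
  apply: IH => //; rewrite ?pE //; first lia.
  (* The left side of the determinant condition is the leading coefficient times the determinant of
     the form; the leading coefficient is [C] here and [A] in [det1]. *)
  apply: (mulfI (x := A)); first by lia.
  apply: etrans (_ : C * A = _); last by ring.
  rewrite -[in RHS]det1; ring.
set p := A * C - B ^+ 2 in ltn p0 hq det1 *.
set q := A * w - B * u in hq det1; set r := A * D - u ^+ 2 in det1.
have [ltrp|lepr] : r < p \/ p <= r by lia.
  rewrite tform_swap23.
  have r0 : 0 < r.
    rewrite -(pmulr_rgt0 _ p0); move/eqP: det1; rewrite subr_eq => /eqP ->.
    by rewrite ltr_wpDr ?sqr_ge0.
  apply: IH => //; first by rewrite -/r; lia.
  by rewrite -/r -/p -[RHS]det1 /q; ring.
(* The binary forms [(A, B, C)] and [(p, q, r)] are now both reduced, of determinants [p] and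
   [A]. *)
have [A1 p1] : A = 1 /\ p = 1.
  apply: reduced_binary_bounds => //.
    exact: reduced_binary_det.
  by rewrite -[in leRHS]det1; exact: reduced_binary_det.
rewrite p1 in hq det1; rewrite A1 in det1 *.
have q0 : q = 0 by lia.
have r1 : r = 1 by rewrite q0 in det1; lia.
exists (x + B * y + u * z), y, z.
have CE : C = 1 + B ^+ 2 by rewrite -p1 /p A1; ring.
have wE : w = B * u by apply/eqP; rewrite -subr_eq0 -q0 /q A1; apply/eqP; ring.
have DE : D = 1 + u ^+ 2 by rewrite -r1 /r A1; ring.
rewrite /tform CE wE DE; ring.
Qed.

(** The form with rows [(v, B, u)], [(B, C, w)], [(u, w, d)] takes the value [d] at [(0, 0, 1)].
    Here [B], [C], [w] are chosen so that [d v - u^2], [d B - u w], [d C - w^2] are [e], [b], [g];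
    then [e g - b^2 = d] is [d] times the determinant, which is therefore 1. *)
Lemma sum3sq_of_residues (d e u b g v : int) :
  0 < d -> 0 < e -> coprimez u d ->
  e = d * v - u ^+ 2 -> e * g = b ^+ 2 + d ->
  sum_of_three_squares d.
Proof.
move=> d0 e0 cud eE egE.
have [[s t] /= st] := coprimezP u d cud.
(* [w = - b / u] modulo [d]. *)
pose w := - (b * s).
have [B BE] : exists B, d * B - u * w = b.
  by exists (b * t); rewrite /w -[RHS]mulr1 -st; ring.
have [C CE] : exists C, d * C - w ^+ 2 = g.
  (* [u^2 (g + w^2) = 0 mod d] *)
  have : (d %| g + w ^+ 2)%Z.
    rewrite -(@Gauss_dvdzr _ (u ^+ 2)); last first.
      by rewrite expr2 coprimezMr coprimez_sym cud.
    apply/dvdzP; exists (v * g - 1 + (d * B - 2 * b) * B).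
    rewrite mulrDr -exprMn.
    have -> : u ^+ 2 = d * v - e by rewrite eE; ring.
    have -> : u * w = d * B - b by rewrite -BE; ring.
    rewrite mulrBl egE; ring.
  by case/dvdzP => C hC; exists C; rewrite mulrC -hC; ring.
have detE : (v * C - B ^+ 2) * (v * d - u ^+ 2) - (v * w - B * u) ^+ 2 = v.
  apply: (mulfI (x := d ^+ 2)); first by rewrite expf_neq0 //; lia.
  have -> : d ^+ 2 * ((v * C - B ^+ 2) * (v * d - u ^+ 2) - (v * w - B * u) ^+ 2)
     = d * v * ((d * v - u ^+ 2) * (d * C - w ^+ 2) - (d * B - u * w) ^+ 2).
    ring.
  by rewrite CE BE -eE egE; ring.
have v0 : 0 < v.
  rewrite -(pmulr_rgt0 _ d0); have -> : d * v = e + u ^+ 2 by rewrite eE; ring.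
  by rewrite ltr_wpDr ?sqr_ge0.
have p0 : 0 < v * C - B ^+ 2.
  rewrite -(pmulr_lgt0 _ e0); have {1}-> : e = v * d - u ^+ 2 by rewrite eE; ring.
  move/eqP: detE; rewrite subr_eq => /eqP ->.
  by rewrite ltr_wpDr ?sqr_ge0.
have -> : d = tform v B C u w d 0 0 1 by rewrite /tform; ring.
exact: tform_det1_sum3sq.
Qed.

(** * Real characters *)

Definition real_char (R : pzRingType) (N : nat) (f : nat -> R) : Prop :=
  [/\ {morph f : m n / (m * n)%N >-> m * n}, forall n, f (n %% N)%N = f n
    & forall n, if coprime n N then f n = 1 \/ f n = -1 else f n = 0].

Lemma real_char1 (R : pzRingType) N (f : nat -> R) : real_char N f -> f 1%N = 1.
Proof.
move=> [fM _ f01]; have := f01 1%N; rewrite coprime1n; have := fM 1%N 1%N.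
by move=> + [] => // h1 h2; move: h1; rewrite h2 mulrNN mulr1.
Qed.

Lemma real_char_exp (R : pzRingType) N (f : nat -> R) n k :
  real_char N f -> f (n ^ k)%N = f n ^+ k.
Proof.
move=> fN; have [fM _ _] := fN; elim: k => [|k IH]; first exact: real_char1 fN.
by rewrite expnS exprS fM IH.
Qed.

Lemma real_char_norm_le1 (R : numDomainType) N (f : nat -> R) n :
  real_char N f -> `|f n| <= 1.
Proof.
move=> [_ _ f01]; have := f01 n; case: ifP => _; last by move=> ->; rewrite normr0.
by case=> ->; rewrite ?normrN normr1.
Qed.

Lemma real_char_intr (R : pzRingType) N (f : nat -> int) :
  real_char N f -> real_char N (fun n => (f n)%:~R : R).
Proof.
move=> [fM fN f01]; split=> [m n|n|n]; first by rewrite fM intrM.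
  by rewrite fN.
by have := f01 n; case: ifP => _ => [[]|] ->; [left|right|].
Qed.

Lemma real_char_mul (R : comPzRingType) N (f g : nat -> R) :
  real_char N f -> real_char N g -> real_char N (fun n => f n * g n).
Proof.
move=> [fM fN f01] [gM gN g01]; split=> [m n|n|n].
- by rewrite fM gM mulrACA.
- by rewrite fN gN.
- have := f01 n; have := g01 n.
  case: ifP => _; last by move=> _ ->; rewrite mul0r.
  by case=> -> [] ->; rewrite ?mulrNN ?mulr1 ?mul1r; [left|right|right|left].
Qed.

(** Multiplication by [b] permutes the residues modulo [N] and changes the sign of the sum. *)
Lemma real_char_sum0 (R : numDomainType) N (f : nat -> R) b :
  (0 < N)%N -> real_char N f -> f b = -1 -> \sum_(i < N) f i = 0.
Proof.
case: N => // N _ [fM fN f01] fb.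
have cb : coprime b N.+1.
  apply/negPn/negP => nc; have := f01 b; rewrite (negPf nc) fb => /eqP.
  by rewrite oppr_eq0 oner_eq0.
pose h (i : 'I_N.+1) : 'I_N.+1 := inord ((b * i) %% N.+1).
have hE i : h i = ((b * i) %% N.+1)%N :> nat by rewrite inordK // ltn_pmod.
have hinj : injective h.
  move=> i j /(congr1 val) /=; rewrite !hE => /eqP.
  wlog leij : i j / (i <= j)%N => [W h1|].
    by case/orP: (leq_total i j) => h2; [|apply/esym]; apply: W; rewrite // eq_sym.
  rewrite eq_sym eqn_mod_dvd ?leq_mul2l ?leij ?orbT // -mulnBr.
  rewrite Gauss_dvdr 1?coprime_sym // => h1; apply/val_inj/eqP.
  rewrite eqn_leq leij /= -subn_eq0; apply/negPn/negP; rewrite -lt0n => h2.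
  by move/dvdn_leq: h1 => /(_ h2); have := ltn_ord j; lia.
have : \sum_i f (h i) = - \sum_(i < N.+1) f i.
  rewrite -sumrN; apply: eq_bigr => i _.
  by rewrite hE fN fM fb mulN1r.
have {1}<- : \sum_(i < N.+1) f i = \sum_i f (h i) by rewrite (reindex_inj hinj).
move/eqP.
by rewrite -addr_eq0 -mulr2n mulrn_eq0 /= => /eqP.
Qed.

(** Complete periods cancel; fewer than [N] terms remain, each of norm at most 1. *)
Lemma real_char_sum_bound (R : numDomainType) N (f : nat -> R) b n :
  (0 < N)%N -> real_char N f -> f b = -1 -> `|\sum_(i < n) f i| <= N%:R.
Proof.
move=> N0 fN fb; have s0 := real_char_sum0 N0 fN fb; have [_ per _] := fN.
elim/ltn_ind: n => n IH.
have [ltnN|leNn] := ltnP n N.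
  apply: le_trans (ler_norm_sum _ _ _) _.
  apply: (@le_trans _ _ (\sum_(i < n) 1)).
    by apply: ler_sum => i _; exact: real_char_norm_le1 fN.
  by rewrite sumr_const card_ord ler_nat ltnW.
rewrite -(subnKC leNn) big_split_ord /= s0 add0r.
rewrite (eq_bigr (fun i : 'I__ => f i)); first by apply: IH; lia.
by move=> i _; rewrite -[LHS]per modnDl per.
Qed.

(** * Partial summation against [n^(-1/2)] *)

Lemma abel_bound (R : realDomainType) (f w : nat -> R) (M : R) m n :
  (forall n, `|\sum_(i < n) f i| <= M) ->
  (forall i, (m <= i)%N -> 0 <= w i.+1 <= w i) -> (m <= n)%N ->
  `|\sum_(m <= i < n) f i * w i| <= 2 * M * w m.
Proof.
move=> fM wd lemn; pose F n := \sum_(i < n) f i.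
have M0 : 0 <= M by apply: le_trans (fM 0%N); rewrite normr_ge0.
have w0 i : (m <= i)%N -> 0 <= w i by case/wd/andP => h1 /(le_trans h1).
(* Summation by parts: the boundary terms join the sum, and the bounds on the remaining terms
   telescope because [w] decreases. *)
have key : `|\sum_(m <= i < n) f i * w i - F n * w n + F m * w m|
             <= M * (w m - w n).
  rewrite -(subnKC lemn); elim: (n - m)%N => [|k IH].
    by rewrite addn0 big_geq // subrr mulr0 sub0r addNr normr0.
  rewrite addnS big_nat_recr ?leq_addr //=.
  set S := \sum_(_ <= _ < _) _ in IH *.
  have -> : F (m + k).+1 = F (m + k)%N + f (m + k)%N by rewrite /F big_ord_recr.
  have -> : S + f (m + k)%N * w (m + k)%N
      - (F (m + k)%N + f (m + k)%N) * w (m + k).+1 + F m * w m =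
     (S - F (m + k)%N * w (m + k)%N + F m * w m) +
     (F (m + k)%N + f (m + k)%N) * (w (m + k)%N - w (m + k).+1) by ring.
  have /andP[h1 h2] := wd _ (leq_addr k m).
  apply: le_trans (ler_normD _ _) _.
  have -> : M * (w m - w (m + k).+1) = M * (w m - w (m + k)%N) +
     M * (w (m + k)%N - w (m + k).+1) by ring.
  apply: lerD => //; rewrite normrM [`|w _ - _|]ger0_norm ?subr_ge0 //.
  by apply: ler_wpM2r; rewrite ?subr_ge0 //; have := fM (m + k).+1; rewrite big_ord_recr.
have h1 : `|F n * w n| <= M * w n.
  by rewrite normrM (ger0_norm (w0 n _)) // ler_wpM2r ?w0 // fM.
have h2 : `|F m * w m| <= M * w m.
  by rewrite normrM (ger0_norm (w0 m _)) // ler_wpM2r ?w0 // fM.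
move: key h1 h2; set S := \sum_(_ <= _ < _) _.
by rewrite !ler_norml => /andP[? ?] /andP[? ?] /andP[? ?]; apply/andP; split; lra.
Qed.

Section InvSqrt.
Variable R : rcfType.
Implicit Types n m : nat.

(** The weight [n^(-1/2)], equal to 0 at 0; not an integer square root. *)
Definition isqrt n : R := (Num.sqrt n%:R)^-1.

Lemma isqrt_ge0 n : 0 <= isqrt n.
Proof. by rewrite invr_ge0 sqrtr_ge0. Qed.

Lemma isqrt1 : isqrt 1 = 1.
Proof. by rewrite /isqrt sqrtr1 invr1. Qed.

Lemma isqrtM m n : isqrt (m * n) = isqrt m * isqrt n.
Proof. by rewrite /isqrt natrM sqrtrM ?ler0n // invfM. Qed.

Lemma isqrt_sqr n : isqrt (n * n) = n%:R^-1.
Proof. by rewrite isqrtM -invfM -expr2 sqr_sqrtr // ler0n. Qed.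

Lemma isqrt_decr n : (0 < n)%N -> 0 <= isqrt n.+1 <= isqrt n.
Proof.
move=> n0; rewrite isqrt_ge0 /= lef_pV2 ?posrE ?sqrtr_gt0 ?ltr0n //.
by rewrite ler_sqrt ?ler0n // ler_nat.
Qed.

(** With [a], [b] the roots of [n] and [n + 1], the induction step is [1 <= 2 b (b - a)], that is
    [0 <= (b - a)^2], since [b^2 - a^2 = 1]. *)
Lemma sum_isqrt_le n : \sum_(1 <= i < n.+1) isqrt i <= 2 * Num.sqrt n%:R.
Proof.
elim: n => [|n IH]; first by rewrite big_geq // sqrtr0 mulr0.
rewrite big_nat_recr //=; apply: le_trans (lerD IH (lexx _)) _.
rewrite /isqrt; set a := Num.sqrt n%:R; set b := Num.sqrt n.+1%:R.
have b0 : 0 < b by rewrite sqrtr_gt0 ltr0n.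
rewrite -(ler_pM2r b0) mulrDl mulVf ?gt_eqF //.
have hb : b * b = n%:R + 1 by rewrite -expr2 sqr_sqrtr ?ler0n // -natr1.
have ha : a * a = n%:R by rewrite -expr2 sqr_sqrtr ?ler0n.
have := sqr_ge0 (b - a); rewrite expr2; nra.
Qed.

End InvSqrt.

(** * Dirichlet convolution of two real characters *)

Lemma ler_sum_subset (R : numDomainType) (I : eqType) (s t : seq I) (F : I -> R) :
  uniq s -> uniq t -> {subset s <= t} -> (forall i, i \in t -> 0 <= F i) ->
  \sum_(i <- s) F i <= \sum_(i <- t) F i.
Proof.
move=> us ut st F0.
have pE : perm_eq s [seq i <- t | i \in s].
  apply: uniq_perm; rewrite ?filter_uniq // => i; rewrite mem_filter.
  by case: (boolP (i \in s)) => // /st ->.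
rewrite (perm_big _ pE) big_filter big_mkcond big_seq [in leRHS]big_seq.
by apply: ler_sum => i /F0; case: ifP.
Qed.

Lemma big_divisors_pfactor (R : nmodType) (p k m : nat) (F : nat -> R) :
  prime p -> coprime p m -> (0 < m)%N ->
  \sum_(d <- divisors (m * p ^ k)) F d =
  \sum_(i <- iota 0 k.+1) \sum_(d <- divisors m) F (p ^ i * d)%N.
Proof.
move=> pp cpm m0; rewrite -(big_allpairs_dep (h := fun i d => p ^ i * d)%N).
have p0 := prime_gt0 pp.
apply: perm_big; apply: uniq_perm; first exact: divisors_uniq.
  apply: allpairs_uniq; rewrite ?iota_uniq ?divisors_uniq //.
  have cop d : (d %| m)%N -> coprime p d by move=> h; exact: coprime_dvdr h cpm.
  move=> [i d] [j e] /allpairsP[[x y] [_ hy [-> ->]]].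
  move=> /allpairsP[[x' y'] [_ hy' [-> ->]]] /= E; rewrite /= in hy hy'.
  move: hy hy'; rewrite -!dvdn_divisors // => hy hy'.
  have y0 := dvdn_gt0 m0 hy; have y0' := dvdn_gt0 m0 hy'.
  have Ex : x = x'.
    have := congr1 (logn p) E; rewrite !lognM ?expn_gt0 ?p0 // !pfactorK //.
    by rewrite !(logn_coprime (cop _ _)) ?addn0.
  by move/eqP: E; rewrite Ex eqn_pmul2l ?expn_gt0 ?p0 // => /eqP ->.
move=> d; rewrite -dvdn_divisors ?muln_gt0 ?m0 ?expn_gt0 ?p0 //.
apply/idP/allpairsP => [dv|[[i e] [hi he ->]]].
  have d0 : (0 < d)%N by apply: dvdn_gt0 dv; rewrite muln_gt0 m0 expn_gt0 p0.
  have [e ce dE] := pfactor_coprime pp d0; exists (logn p d, e).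
  split; last by rewrite /= mulnC.
    rewrite mem_iota /= add0n ltnS -(dvdn_Pexp2l _ _ (prime_gt1 pp)).
    rewrite -(@Gauss_dvdr _ m) ?coprimeXl //.
    exact: dvdn_trans (pfactor_dvdnn _ _) dv.
  rewrite /= -dvdn_divisors // -(@Gauss_dvdl _ _ (p ^ k)) ?coprimeXr 1?coprime_sym //.
  by apply: dvdn_trans dv; rewrite [X in (_ %| X)%N]dE dvdn_mulr.
rewrite mem_iota add0n /= in hi; rewrite /= -dvdn_divisors // in he.
by rewrite mulnC dvdn_mul // dvdn_exp2l.
Qed.

Definition conv (R : pzRingType) (f g : nat -> R) (n : nat) : R :=
  \sum_(d <- divisors n) f d * g (n %/ d)%N.

(** The complete homogeneous symmetric polynomial of degree [k]; at [(f p, g p)] it is the value of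
    [conv f g] at [p ^ k]. *)
Definition hsum (R : pzRingType) (x y : R) (k : nat) : R :=
  \sum_(i <- iota 0 k.+1) x ^+ i * y ^+ (k - i).

Lemma hsumS (R : comPzRingType) (x y : R) k :
  hsum x y k.+1 = y * hsum x y k + x ^+ k.+1.
Proof.
rewrite /hsum -[k.+2]addn1 iotaD big_cat big_seq1 add0n subnn expr0 mulr1.
congr (_ + _); rewrite mulr_sumr big_seq [RHS]big_seq; apply: eq_bigr => i.
by rewrite mem_iota add0n ltnS => /= ik; rewrite subSn // exprS mulrCA.
Qed.

Lemma hsum_sign_ge (R : numDomainType) (x y : R) k :
  (x = 1 \/ x = -1) -> (y = 1 \/ y = -1) -> ~ (x = -1 /\ y = -1) ->
  (~~ odd k)%:R <= hsum x y k.
Proof.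
have h0 x' y' : hsum x' y' 0 = 1 :> R.
  by rewrite /hsum big_seq1 !expr0 mulr1.
case=> ->; case=> -> // nm.
- elim: k => [|k IH]; first by rewrite h0.
  rewrite hsumS expr1n mul1r; apply: (@le_trans _ _ (0 + 1)).
    by rewrite add0r (_ : 1 = 1%:R) // ler_nat; case: (~~ _).
  by rewrite lerD2r; apply: le_trans IH; rewrite ler0n.
- suff -> : hsum 1 (-1) k = (~~ odd k)%:R :> R by [].
  elim: k => [|k IH]; first by rewrite h0.
  by rewrite hsumS IH expr1n mulN1r /=; case: odd; rewrite ?oppr0 ?add0r ?addNr.
- suff -> : hsum (-1) 1 k = (~~ odd k)%:R :> R by [].
  elim: k => [|k IH]; first by rewrite h0.
  by rewrite hsumS IH mul1r -signr_odd /=; case: odd; rewrite /= ?expr0 ?add0r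
    ?expr1 ?addrN.
- by case: nm.
Qed.

Section ConvChars.
Variables (R : numDomainType) (N : nat) (f g : nat -> R).
Hypotheses (fN : real_char N f) (gN : real_char N g).

(** The Euler factor at [p]; inductions on [n] strip off the smallest prime factor with it. *)
Lemma conv_pfactor p k m : prime p -> coprime p m -> (0 < m)%N ->
  conv f g (m * p ^ k) = hsum (f p) (g p) k * conv f g m.
Proof.
move=> pp cpm m0; rewrite /conv big_divisors_pfactor // /hsum mulr_suml.
have [fM _ _] := fN; have [gM _ _] := gN.
rewrite big_seq [RHS]big_seq; apply: eq_bigr => i.
rewrite mem_iota add0n ltnS => /= ik.
rewrite mulr_sumr big_seq [RHS]big_seq; apply: eq_bigr => d.
rewrite -dvdn_divisors // => dm.
have -> : ((m * p ^ k) %/ (p ^ i * d) = p ^ (k - i) * (m %/ d))%N.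
  rewrite mulnC divnMA -(subnK ik) expnD mulnAC mulnK ?expn_gt0 ?prime_gt0 //.
  by rewrite addnK muln_divA.
by rewrite fM gM !(real_char_exp _ _ fN, real_char_exp _ _ gN) mulrACA.
Qed.

Hypothesis noneg : forall p, prime p -> ~ (f p = -1 /\ g p = -1).

Lemma hsum_prime_ge0 p k : prime p -> 0 <= hsum (f p) (g p) k.
Proof.
move=> pp; have [_ _ f01] := fN; have [_ _ g01] := gN.
have := f01 p; have := g01 p; case: ifP => _ hg hf.
  apply: le_trans (hsum_sign_ge k hf hg (noneg pp)); exact: ler0n.
by rewrite hf hg; apply: sumr_ge0 => i _; rewrite mulr_ge0 ?exprn_ge0.
Qed.

Lemma conv1 : conv f g 1 = 1.
Proof. by rewrite /conv big_seq1 divn1 (real_char1 fN) (real_char1 gN) mulr1. Qed.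

Lemma conv_ge0 n : (0 < n)%N -> 0 <= conv f g n.
Proof.
elim/ltn_ind: n => n IH n0; have [n1|n1] := leqP n 1.
  by have -> : n = 1%N by [lia|]; rewrite conv1.
have pp := pdiv_prime n1; have [m cm nE] := pfactor_coprime pp n0.
have m0 : (0 < m)%N by move: n0; rewrite nE muln_gt0 => /andP[].
have k0 : (0 < logn (pdiv n) n)%N by rewrite -pfactor_dvdn // pdiv_dvd.
rewrite nE conv_pfactor // mulr_ge0 ?hsum_prime_ge0 // IH // [X in (_ < X)%N]nE.
by rewrite -{1}[m]muln1 ltn_pmul2l // -{1}(expn0 (pdiv n)) ltn_exp2l ?prime_gt1.
Qed.

(** Every prime has an even exponent in [n * n], and for even exponents [hsum_sign_ge] bounds the
    Euler factor below by 1. *)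
Lemma conv_sqr_ge1 n : (0 < n)%N -> coprime n N -> 1 <= conv f g (n * n).
Proof.
elim/ltn_ind: n => n IH n0 cn; have [n1|n1] := leqP n 1.
  by have -> : n = 1%N by [lia|]; rewrite conv1.
have pp := pdiv_prime n1; have [m cm nE] := pfactor_coprime pp n0.
have m0 : (0 < m)%N by move: n0; rewrite nE muln_gt0 => /andP[].
have k0 : (0 < logn (pdiv n) n)%N by rewrite -pfactor_dvdn // pdiv_dvd.
have ltmn : (m < n)%N.
  rewrite [X in (_ < X)%N]nE.
  by rewrite -{1}[m]muln1 ltn_pmul2l // -{1}(expn0 (pdiv n)) ltn_exp2l ?prime_gt1.
have cmN : coprime m N.
  by apply: coprime_dvdl cn; rewrite [X in (_ %| X)%N]nE dvdn_mulr.
have cpN : coprime (pdiv n) N by apply: coprime_dvdl cn; exact: pdiv_dvd.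
rewrite {1 2}nE mulnACA -expnD conv_pfactor ?coprimeMr ?cm ?muln_gt0 ?m0 //.
rewrite -[1]mulr1; apply: ler_pM => //; last exact: IH.
have [_ _ f01] := fN; have [_ _ g01] := gN.
have := f01 (pdiv n); have := g01 (pdiv n); rewrite cpN => hg hf.
apply: le_trans (hsum_sign_ge _ hf hg (noneg pp)).
by rewrite addnn odd_double.
Qed.

End ConvChars.

(** * The hyperbola method and common primes of two characters *)

Lemma harmonic_pow2 (R : realFieldType) k :
  k%:R / 2 <= \sum_(1 <= i < (2 ^ k).+1) (i%:R)^-1 :> R.
Proof.
elim: k => [|k IH]; first by rewrite mul0r big_nat1 invr1.
rewrite (@big_cat_nat _ _ _ (2 ^ k).+1) /= ?ltnS ?leq_exp2l //.
rewrite -natr1 mulrDl lerD //.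
apply: (@le_trans _ _ (\sum_((2 ^ k).+1 <= i < (2 ^ k.+1).+1) (2 ^ k.+1)%:R^-1)).
  rewrite sumr_const_nat subSS expnS mul2n -addnn addnK -[leRHS]mulr_natl natrD.
  have h : (2 ^ k)%:R != 0 :> R by rewrite pnatr_eq0 expn_eq0.
  have -> : (2 ^ k)%:R + (2 ^ k)%:R = (2 ^ k)%:R * 2 :> R by ring.
  by rewrite invfM mulVKf // mul1r.
apply: ler_sum_nat => i /andP[h1 h2].
by rewrite lef_pV2 ?posrE ?ltr0n ?ler_nat ?expn_gt0 // (leq_trans _ h1).
Qed.

Lemma sum_multiples (R : nmodType) (G : nat -> R) a X : (0 < a)%N ->
  \sum_(1 <= b < X.+1 | (a * b <= X)%N) G (a * b)%N =
  \sum_(1 <= n < X.+1 | (a %| n)%N) G n.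
Proof.
move=> a0; rewrite -big_filter -(big_map (muln a) xpredT) -[RHS]big_filter.
apply: perm_big; apply: uniq_perm; rewrite ?filter_uniq ?iota_uniq //.
  rewrite map_inj_uniq ?filter_uniq ?iota_uniq // => x y /eqP.
  by rewrite eqn_pmul2l // => /eqP.
move=> n; rewrite mem_filter mem_index_iota; apply/mapP/idP.
  move=> [b]; rewrite mem_filter mem_index_iota => /and3P[h1 h2 h3] ->.
  by rewrite dvdn_mulr //= muln_gt0 a0 h2 ltnS.
case/and3P=> /dvdnP[b ->] h0 h; exists b; last by rewrite mulnC.
have b0 : (0 < b)%N by move: h0; rewrite muln_gt0 => /andP[].
rewrite mem_filter mem_index_iota b0 mulnC -ltnS h /=.
by apply: leq_ltn_trans h; rewrite leq_pmulr.
Qed.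

Lemma sum_conv (R : comPzRingType) (f g w : nat -> R) X :
  (forall a b, w (a * b)%N = w a * w b) ->
  \sum_(1 <= n < X.+1) conv f g n * w n =
  \sum_(1 <= a < X.+1) \sum_(1 <= b < X.+1 | (a * b <= X)%N)
     (f a * w a) * (g b * w b).
Proof.
move=> wM; pose F a n := f a * g (n %/ a)%N * w n.
transitivity (\sum_(1 <= a < X.+1) \sum_(1 <= n < X.+1 | (a %| n)%N) F a n).
  rewrite (exchange_big_dep_nat xpredT) //=.
  rewrite big_nat [RHS]big_nat; apply: eq_bigr => n /andP[n0 nX].
  rewrite /conv mulr_suml -[RHS]big_filter; apply: perm_big; apply: uniq_perm.
  - exact: divisors_uniq.
  - by rewrite filter_uniq ?iota_uniq.
  - move=> d; rewrite -dvdn_divisors // mem_filter mem_index_iota.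
    case: (boolP (d %| n)%N) => //= h; rewrite (dvdn_gt0 n0 h) /=.
    by rewrite (leq_ltn_trans (dvdn_leq n0 h)).
rewrite big_nat [RHS]big_nat; apply: eq_bigr => a /andP[a0 aX].
rewrite -sum_multiples //; apply: eq_bigr => b _.
by rewrite /F mulKn // wM; ring.
Qed.

Lemma big_nat_mul_le (R : nmodType) (H : nat -> R) a m X : (0 < a)%N ->
  \sum_(m <= b < X.+1 | (a * b <= X)%N) H b = \sum_(m <= b < (X %/ a).+1) H b.
Proof.
move=> a0; rewrite [RHS](@big_nat_widen _ _ _ _ _ X.+1) ?ltnS ?leq_div //.
by apply: eq_bigl => b; rewrite ltnS leq_divRL // mulnC.
Qed.

(** If [a b <= Y^2] then [a <= Y] or [b <= Y]: the terms are the box [a, b <= Y], which lies wholly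
    under the hyperbola, and the parts [a <= Y < b] and [b <= Y < a]. *)
Lemma hyperbola_split (R : comPzRingType) (F G : nat -> R) Y :
  \sum_(1 <= a < (Y * Y).+1) \sum_(1 <= b < (Y * Y).+1 | (a * b <= Y * Y)%N)
    F a * G b =
  (\sum_(1 <= a < Y.+1) F a) * (\sum_(1 <= b < Y.+1) G b) +
  \sum_(1 <= a < Y.+1) F a * (\sum_(Y.+1 <= b < ((Y * Y) %/ a).+1) G b) +
  \sum_(1 <= b < Y.+1) G b * (\sum_(Y.+1 <= a < ((Y * Y) %/ b).+1) F a).
Proof.
have leYX : (Y <= Y * Y)%N by case: (Y) => // n; rewrite leq_pmulr.
rewrite (@big_cat_nat _ _ _ Y.+1) ?ltnS //=; congr (_ + _).
  rewrite mulr_suml -big_split big_nat [RHS]big_nat /=.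
  apply: eq_bigr => a /andP[a0 aY].
  rewrite big_nat_mul_le // -mulr_sumr -mulrDr; congr (_ * _).
  by rewrite (@big_cat_nat _ _ _ Y.+1) //= ltnS leq_divRL // leq_mul2l orbC -ltnS aY.
rewrite (exchange_big_dep_nat (fun b => b < Y.+1)%N) /=; last first.
  move=> a b /andP[h1 _] _ _ h2; rewrite ltnNge; apply/negP => h3.
  by have := leq_mul h1 h3; lia.
transitivity (\sum_(1 <= b < Y.+1)
    \sum_(Y.+1 <= a < (Y * Y).+1 | (a * b <= Y * Y)%N) F a * G b).
  by rewrite [RHS](@big_nat_widen _ _ _ _ _ (Y * Y).+1) ?ltnS.
rewrite [LHS]big_nat [RHS]big_nat; apply: eq_bigr => b /andP[b0 bY]; rewrite mulr_sumr -big_nat_mul_le //.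
by apply: eq_big => [a|a _]; [rewrite mulnC | rewrite mulrC].
Qed.

(** The box contributes at most [(2 N)^2]. In the other two parts the inner sums are at most
    [2 N (Y + 1)^(-1/2)] and the outer weights add up to at most [2 Y^(1/2)], so each part is at
    most [4 N], uniformly in [Y]. *)
Lemma conv_sum_bound (R : rcfType) N (f g : nat -> R) bf bg Y :
  (0 < N)%N -> real_char N f -> real_char N g -> f bf = -1 -> g bg = -1 ->
  `|\sum_(1 <= n < (Y * Y).+1) conv f g n * isqrt R n|
    <= 4 * N%:R ^+ 2 + 8 * N%:R.
Proof.
move=> N0 fN gN fb gb; rewrite sum_conv ?hyperbola_split; last exact: isqrtM.
have tail h bh m n : real_char N h -> h bh = -1 -> (0 < m)%N ->
    `|\sum_(m <= b < n) h b * isqrt R b| <= 2 * N%:R * isqrt R m.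
  move=> hN hb m0; have [lemn|ltnm] := leqP m n.
    apply: abel_bound => // [k|i mi]; first exact: real_char_sum_bound hb.
    by apply: isqrt_decr; apply: leq_trans mi.
  by rewrite big_geq ?normr0 1?ltnW // !mulr_ge0 ?isqrt_ge0 ?ler0n.
have side h k bh bk : real_char N h -> real_char N k -> h bh = -1 -> k bk = -1 ->
    `|\sum_(1 <= a < Y.+1) h a * isqrt R a *
       (\sum_(Y.+1 <= b < ((Y * Y) %/ a).+1) k b * isqrt R b)| <= 4 * N%:R.
  move=> hN kN hb kb; apply: le_trans (ler_norm_sum _ _ _) _.
  apply: (@le_trans _ _ (\sum_(1 <= a < Y.+1) isqrt R a * (2 * N%:R * isqrt R Y.+1))).
    apply: ler_sum => a _; rewrite normrM; apply: ler_pM; rewrite ?normr_ge0 //.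
      rewrite normrM [`|isqrt _ _|]ger0_norm ?isqrt_ge0 // ler_piMl ?isqrt_ge0 //.
      exact: real_char_norm_le1 hN.
    exact: tail kb _.
  rewrite -mulr_suml.
  have h1 := sum_isqrt_le R Y.
  have h2 : Num.sqrt Y%:R * isqrt R Y.+1 <= 1.
    rewrite ler_pdivrMr ?sqrtr_gt0 ?ltr0n // mul1r ler_sqrt ?ler0n //.
    by rewrite ler_nat.
  have h3 : (0 : R) <= N%:R by rewrite ler0n.
  have h4 := isqrt_ge0 R Y.+1.
  apply: (@le_trans _ _ ((2 * Num.sqrt Y%:R) * (2 * N%:R * isqrt R Y.+1))).
    by rewrite ler_wpM2r // !mulr_ge0.
  have -> : 2 * Num.sqrt Y%:R * (2 * N%:R * isqrt R Y.+1) =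
     4 * N%:R * (Num.sqrt Y%:R * isqrt R Y.+1) by ring.
  by rewrite ler_piMr // mulr_ge0.
have := tail f bf 1%N Y.+1 fN fb isT; have := tail g bg 1%N Y.+1 gN gb isT.
have := side f g bf bg fN gN fb gb; have := side g f bg bf gN fN gb fb.
rewrite isqrt1 mulr1.
set S1 := \sum_(_ <= _ < _) _; set S2 := \sum_(_ <= _ < _) _.
set G := \sum_(_ <= _ < _) _; set F := \sum_(_ <= _ < _) _.
move=> s1 s2 hG hF.
have hFG : `|F * G| <= 4 * N%:R ^+ 2.
  have -> : 4 * N%:R ^+ 2 = (2 * N%:R) * (2 * N%:R) :> R by ring.
  by rewrite normrM; apply: ler_pM.
apply: le_trans (ler_normD _ _) _.
have := ler_normD (F * G) S2; lra.
Qed.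

(* If [f] and [g] never take the value [-1] at a common prime, then the
   Dirichlet convolution [f * g] is nonnegative, and at least [1] on squares
   prime to [N]; so its sum against [1 / sqrt n] dominates a harmonic series. *)
Lemma exists_prime_both_neg N (f g : nat -> int) bf bg :
  (0 < N)%N -> real_char N f -> real_char N g -> f bf = -1 -> g bg = -1 ->
  exists2 p, prime p & f p = -1 /\ g p = -1.
Proof.
move=> N0 fN0 gN0 fb0 gb0; apply: contrapT => none.
pose R : rcfType := algR.
pose f' n : R := (f n)%:~R; pose g' n : R := (g n)%:~R.
have fN : real_char N f' by exact: real_char_intr.
have gN : real_char N g' by exact: real_char_intr.
have fb : f' bf = -1 by rewrite /f' fb0 intrN.
have gb : g' bg = -1 by rewrite /g' gb0 intrN.
have noneg p : prime p -> ~ (f' p = -1 /\ g' p = -1).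
  move=> pp [h1 h2]; apply: none; exists p => //; split; apply/eqP.
    by rewrite -(eqr_int R) intrN; apply/eqP.
  by rewrite -(eqr_int R) intrN; apply/eqP.
have k0 : exists k : nat, 4 * N%:R ^+ 2 + 8 * N%:R < k%:R / 2 / (2 * N%:R) :> R.
  (* For this [k] the right side exceeds the left side by exactly 1. *)
  exists (4 * N * (4 * (N * N) + 8 * N + 1))%N.
  have N1 : (0 : R) < N%:R by rewrite ltr0n.
  rewrite ltr_pdivlMr ?mulr_gt0 // ltr_pdivlMr // !(natrM, natrD).
  by nra.
have [k hk] := k0.
pose Y := (N * 2 ^ k).+1.
have := conv_sum_bound Y N0 fN gN fb gb.
apply/negP; rewrite -ltNge; apply: lt_le_trans hk _.
apply: le_trans _ (ler_norm _).
(* The numbers [N j + 1] are prime to [N] and at most [2 N j], so each of their squares contributes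
   at least [1 / (2 N j)]. *)
pose s := [seq (N * j).+1 | j <- index_iota 1 (2 ^ k).+1].
have us : uniq [seq (n * n)%N | n <- s].
  rewrite !map_inj_uniq ?iota_uniq // => [x y|x y].
    by move=> /eqP; rewrite eqSS eqn_pmul2l // => /eqP.
  by move=> h; nia.
apply: (@le_trans _ _ (\sum_(n <- [seq (n * n)%N | n <- s]) conv f' g' n * isqrt R n)).
  rewrite !big_map; apply: (@le_trans _ _
     (\sum_(j <- index_iota 1 (2 ^ k).+1) j%:R^-1 / (2 * N%:R))).
    rewrite -mulr_suml ler_wpM2r ?invr_ge0 ?mulr_ge0 ?ler0n //.
    exact: harmonic_pow2.
  rewrite big_seq [leRHS]big_seq; apply: ler_sum => j.
  rewrite mem_index_iota => /andP[j0 _].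
  have cN : coprime (N * j).+1 N.
    by rewrite coprime_sym -addn1 /coprime mulnC gcdnMDl gcdn1.
  have := @conv_sqr_ge1 R N f' g' fN gN noneg (N * j).+1 isT cN.
  rewrite isqrt_sqr => h1; rewrite -invfM.
  apply: (@le_trans _ _ ((N * j).+1%:R^-1)).
    rewrite lef_pV2 ?posrE ?ltr0n ?mulr_gt0 ?ltr0n // -!natrM ler_nat.
    by nia.
  by rewrite ler_peMl // invr_ge0 ler0n.
apply: ler_sum_subset => //; first exact: iota_uniq.
  move=> n /mapP[m /mapP[j]]; rewrite !mem_index_iota => /andP[j0 j1] -> ->.
  have h : (N * j < Y)%N by rewrite ltnS leq_mul2l -ltnS j1 orbT.
  by rewrite muln_gt0 /= ltnS leq_mul.
move=> n; rewrite mem_index_iota => /andP[n0 _].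
by rewrite mulr_ge0 ?isqrt_ge0 // (conv_ge0 fN gN noneg).
Qed.

(** * The kernel of a real character modulo squares *)

(** Take [M] maximal among the subgroups containing [H] and avoiding [a]. If [b] is not in [M], then
    [a] is in the group generated by [M] and [b]; as [b^2] is in [M], so is [a b^-1]. Thus the
    complement of [M] is the single coset of [a]. *)
Lemma exists_index2_avoiding (gT : finGroupType) (H : {group gT}) (a : gT) :
  abelian [set: gT] -> (forall x : gT, (x * x)%g \in H) -> a \notin H ->
  exists M : {group gT}, [/\ H \subset M, a \notin M
    & forall b c, b \notin M -> c \notin M -> (b * c)%g \in M].
Proof.
move=> abG sqH aH.
have [M /maxgroupP[aM maxM] sHM] :=
  @maxgroup_exists _ (fun K : {group gT} => a \notin K) H aH.
exists M; split=> //.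
have cc (x y : gT) : (x * y = y * x)%g.
  by apply: (centsP abG); rewrite inE.
have sqM x : (x * x)%g \in M by rewrite (subsetP sHM).
have key b : b \notin M -> (a * b^-1)%g \in M.
  move=> bM; have : a \in (M <*> <[b]>)%g.
    apply/negPn/negP => h; move/negP: bM; apply.
    have E : (M <*> <[b]>)%g = M :> {set gT}.
      by apply: (maxM (M <*> <[b]>)%G) => //; exact: joing_subl.
    by rewrite -E -cycle_subG joing_subr.
  rewrite norm_joinEr; last first.
    by apply/cents_norm/(sub_abelian_cent2 abG); exact: subsetT.
  case/mulsgP=> m y mM /cycleP[i ->] aE.
  have h : (b ^+ (i./2).*2)%g \in M by rewrite -addnn expgD.
  move: aE; rewrite -(odd_double_half i); case: (odd i) => /= aE.
    rewrite aE add1n expgSr mulgA mulgK groupM //.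
  by case/negP: aM; rewrite aE add0n groupM.
move=> b c /key hb /key hc; have := groupM hb hc.
have -> : (a * b^-1 * (a * c^-1) = (a * a) * (b * c)^-1)%g.
  rewrite invMg (cc c^-1)%g -!mulgA; congr (_ * _)%g.
  by rewrite !mulgA (cc b^-1)%g.
by rewrite groupMl // groupV.
Qed.

Section KernelRepresentatives.
Variables (N : nat) (chi : nat -> int).
Hypotheses (N1 : (1 < N)%N) (chiN : real_char N chi).

(** The default value 1 is taken when [n] is not prime to [N]. *)
Definition unit_of_nat (n : nat) : {unit 'Z_N} :=
  insubd (1%g : {unit 'Z_N}) (n%:R : 'Z_N).

Lemma val_unit_of_nat n : coprime n N -> \val (unit_of_nat n) = n%:R.
Proof. by move=> cn; rewrite val_insubd unitZpE // coprime_sym cn. Qed.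

Lemma unit_of_natM m n : coprime m N -> coprime n N ->
  unit_of_nat (m * n) = (unit_of_nat m * unit_of_nat n)%g.
Proof.
move=> cm cn; apply: val_inj; rewrite FinRing.val_unitM.
by rewrite !val_unit_of_nat ?coprimeMl ?cm // natrM.
Qed.

Lemma natr_mod n : (n %% N)%N%:R = n%:R :> 'Z_N.
Proof. by apply: ord_inj; rewrite !val_Zp_nat // modn_mod. Qed.

Lemma unit_of_nat_mod n : unit_of_nat (n %% N) = unit_of_nat n.
Proof. by rewrite /unit_of_nat natr_mod. Qed.

Lemma unit_of_nat_surj (u : {unit 'Z_N}) :
  exists2 n, coprime n N & u = unit_of_nat n.
Proof.
have nE : (\val u : 'Z_N)%:R = \val u :> 'Z_N by rewrite natr_Zp.
exists (\val u : 'Z_N); last by apply: val_inj; rewrite val_insubd nE (valP u).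
by rewrite coprime_sym -unitZpE // nE (valP u).
Qed.

Lemma index2_real_char (M : {group {unit 'Z_N}}) :
  (forall b c, b \notin M -> c \notin M -> (b * c)%g \in M) ->
  real_char N (fun n => if coprime n N then
                          if unit_of_nat n \in M then 1 else -1 else 0 : int).
Proof.
move=> M2; split=> [m n|n|n].
- rewrite coprimeMl; case: (boolP (coprime m N)) => cm; last by rewrite mul0r.
  case: (boolP (coprime n N)) => cn /=; last by rewrite mulr0.
  rewrite unit_of_natM //; case: (boolP (_ m \in M)) => hm.
    by rewrite groupMl // mul1r.
  case: (boolP (_ n \in M)) => hn; first by rewrite groupMr // (negPf hm) mulr1.
  by rewrite M2.
- by rewrite coprime_modl unit_of_nat_mod.
- by case: coprime => //; case: (_ \in M); [left|right].
Qed.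

(* Modulo squares, the kernel of [chi] is generated by the primes it contains:
   otherwise some real character [psi] trivial on these primes has
   [psi a = -1], and the real characters [psi] and [chi * psi] would be [-1] at
   a common prime. *)
Lemma real_char_kernel_rep (P : nat -> Prop) a :
  coprime a N -> chi a = 1 -> P 1%N ->
  (forall e p, P e -> prime p -> coprime p e -> chi p = 1 -> P (p * e)%N) ->
  (forall e f, (f %| e)%N -> P e -> P f) ->
  exists e s, [/\ (0 < e)%N, coprime s N, e = a * s ^ 2 %[mod N] & P e].
Proof.
move=> ca chia P1 Pmul Pdvd; have [chiM chiP chi01] := chiN.
pose splitp u := `[< exists p, [/\ prime p, chi p = 1 & u = unit_of_nat p] >].
pose sq (u : {unit 'Z_N}) := [exists v : {unit 'Z_N}, u == (v * v)%g].
pose A := [set u : {unit 'Z_N} | splitp u || sq u].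
have abG : abelian [set: {unit 'Z_N}] by exact: units_Zp_abelian.
have aA : unit_of_nat a \in <<A>>%g.
  apply/negPn/negP => naA.
  have [|M [sAM aM M2]] := exists_index2_avoiding abG _ naA.
    by move=> x; apply: mem_gen; rewrite inE; apply/orP; right; apply/existsP; exists x.
  have psiN := index2_real_char M2; set psi := fun n => _ in psiN.
  have psia : psi a = -1 by rewrite /psi ca (negPf aM).
  have phia : chi a * psi a = -1 by rewrite chia psia mul1r.
  have [p pp [pp1]] := exists_prime_both_neg (ltnW N1) psiN
    (real_char_mul chiN psiN) psia phia.
  rewrite pp1 mulrN1 => /oppr_inj chip.
  have : unit_of_nat p \in M.
    rewrite (subsetP sAM) // mem_gen // inE; apply/orP; left.
    by apply/asboolP; exists p.
  by move: pp1; rewrite /psi; case: coprime => //; case: (_ \in M).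
(* [u] is represented up to a square by some [e] in [P]; this is proved by induction on the number
   of generators in a product. *)
pose T (u : {unit 'Z_N}) := exists e (s : {unit 'Z_N}),
  [/\ (0 < e)%N, e%:R = \val (u * (s * s))%g :> 'Z_N & P e].
suff : T (unit_of_nat a).
  case=> e [t [e0 eE Pe]]; have [s cs tE] := unit_of_nat_surj t.
  exists e, s; split=> //.
  move: eE; rewrite tE -!unit_of_natM ?coprimeMl ?cs //.
  rewrite val_unit_of_nat ?coprimeMl ?ca ?cs // mulnn.
  by move/(congr1 (fun x : 'Z_N => x : nat)); rewrite !val_Zp_nat.
have cc (x y : {unit 'Z_N}) : (x * y = y * x)%g.
  by apply: (centsP abG); rewrite inE.
case/gen_prodgP: aA => n [c cA ->].
elim: n c cA => [|n IH] c cA.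
  exists 1%N, 1%g; split=> //.
  by rewrite big_ord0 !mulg1.
rewrite big_ord_recl.
have [e [s [e0 eE Pe]]] := IH (fun i => c (lift ord0 i)) (fun i => cA _).
move: (\prod_i _)%g eE => u eE.
have := cA ord0; rewrite inE => /orP[/asboolP[p [pp chip cE]]|/existsP[v /eqP cE]].
  have cp : coprime p N.
    apply/negPn/negP => nc; have := chi01 p; rewrite (negPf nc) chip.
    by move/eqP; rewrite oner_eq0.
  (* If [p] divides [e], then [Pmul] does not apply; [e] is divided by [p] instead, which modulo
     squares amounts to multiplying by [p]. *)
  have [pe|npe] := boolP (p %| e)%N.
    have [f fE] : exists f, e = (p * f)%N.
      by case/dvdnP: pe => f ->; exists f; rewrite mulnC.
    exists f, (s * (c ord0)^-1)%g; split.
    - by move: e0; rewrite fE muln_gt0 => /andP[].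
    - apply: (mulrI (valP (c ord0))).
      rewrite [LHS](_ : _ = e%:R); last by rewrite fE natrM cE val_unit_of_nat.
      rewrite eE -FinRing.val_unitM; congr (\val _).
      have -> : (s * (c ord0)^-1 * (s * (c ord0)^-1) =
                 (s * s) * ((c ord0)^-1 * (c ord0)^-1))%g.
        by rewrite -!mulgA; congr (_ * _)%g; rewrite !mulgA (cc _ s).
      move: (c ord0) (s * s)%g => k q.
      by rewrite !mulgA -(mulgA (k * k))%g (cc (k * k))%g (mulgA (u * q))%g !mulgK.
    - by apply: Pdvd Pe; rewrite fE dvdn_mull.
  exists (p * e)%N, s; split=> //; first by rewrite muln_gt0 prime_gt0.
    rewrite natrM eE cE -(mulgA (unit_of_nat p)) [RHS]FinRing.val_unitM.
    by rewrite val_unit_of_nat.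
  by apply: Pmul => //; rewrite prime_coprime.
exists e, (s * v^-1)%g; split=> //; rewrite eE cE; congr (\val _).
have -> : (s * v^-1 * (s * v^-1) = (s * s) * (v * v)^-1)%g.
  by rewrite invMg -!mulgA; congr (_ * _)%g; rewrite !mulgA (cc _ s).
by move: (v * v)%g (s * s)%g => k q; rewrite !mulgA -(mulgA k) (cc k) mulgK.
Qed.

End KernelRepresentatives.

(** * Quadratic reciprocity *)

(** The Legendre symbol of [n] modulo [q], through Euler's criterion; [legendre1_sqrt] recovers
    square roots. *)
Definition legendre (q n : nat) : int :=
  if (q %| n)%N then 0 else if (n ^ q./2 %% q == 1)%N then 1 else -1.

(** For odd [n], the Jacobi symbol of -1 modulo [n]. *)
Definition sgn4 (n : nat) : int :=
  if odd n then if (n %% 4 == 1)%N then 1 else -1 else 0.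

(** For odd [n], the Jacobi symbol of 2 modulo [n]. *)
Definition sgn8 (n : nat) : int :=
  if odd n then if (n %% 8 == 1)%N || (n %% 8 == 7)%N then 1 else -1 else 0.

Definition rsgn (p q : nat) : int :=
  if (p %% 4 == 3)%N && (q %% 4 == 3)%N then -1 else 1.

Section Legendre.
Variable q : nat.
Hypotheses (qP : prime q) (q_odd : odd q).

Let qE : q = (q./2).*2.+1.
Proof. by rewrite -[LHS]odd_double_half q_odd. Qed.

Lemma natrF_eq0 n : (n%:R == 0 :> 'F_q) = (q %| n)%N.
Proof. by rewrite (dvdn_pcharf (pchar_Fp qP)). Qed.

Lemma legendreE n : (legendre q n)%:~R = n%:R ^+ q./2 :> 'F_q.
Proof.
have h0 : (0 < q./2)%N by have := prime_gt1 qP; lia.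
rewrite /legendre -natrF_eq0; case: (altP (n%:R =P 0 :> 'F_q)) => [->|n0].
  by rewrite expr0n eqn0Ngt h0.
have -> : (n ^ q./2 %% q == 1)%N = (n%:R ^+ q./2 == 1 :> 'F_q).
  rewrite -natrX; apply/eqP/eqP => [h|].
    by rewrite -(Fp_nat_mod qP) h.
  by move=> h; rewrite -(val_Fp_nat qP) h.
have : (n%:R ^+ q./2) ^+ 2 == 1 :> 'F_q.
  rewrite -exprM muln2; apply/eqP; apply: (mulfI n0); rewrite mulr1 -exprS -qE.
  by have := expf_card (n%:R : 'F_q); rewrite card_Fp.
by rewrite sqrf_eq1; case: ifP => [/eqP-> //|_ /= /eqP ->]; rewrite intrN.
Qed.

Lemma legendre_cases n :
  [\/ legendre q n = 0, legendre q n = 1 | legendre q n = -1].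
Proof.
rewrite /legendre; case: ifP => _; first by constructor 1.
by case: ifP => _; [constructor 2|constructor 3].
Qed.

(** Since -1, 0, 1 are distinct modulo an odd prime, identities between symbols can be checked in
    ['F_q]. *)
Lemma signF_inj (x y : int) : [\/ x = 0, x = 1 | x = -1] ->
  [\/ y = 0, y = 1 | y = -1] -> x%:~R = y%:~R :> 'F_q -> x = y.
Proof.
have q2 : (2 < q)%N by have := prime_gt1 qP; lia.
have zE (z : int) : (z%:~R == 0 :> 'F_q) = (q %| absz z)%N.
  by case: z => n; rewrite ?NegzE ?intrN ?oppr_eq0 ?abszN natrF_eq0.
move=> hx hy /eqP; rewrite -subr_eq0 -intrB zE => qxy.
apply/eqP; rewrite -subr_eq0 -absz_eq0 -leqn0 leqNgt; apply/negP => xy0.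
have := dvdn_leq xy0 qxy.
by case: hx => ->; case: hy => -> /=; lia.
Qed.

Lemma sign_cases (b : bool) :
  [\/ (-1) ^+ b = 0 :> int, (-1) ^+ b = 1 :> int | (-1) ^+ b = -1 :> int].
Proof. by case: b; [constructor 3|constructor 2]. Qed.

Lemma legendre_real_char : real_char q (legendre q).
Proof.
split=> [m n|n|n].
- apply: signF_inj; first exact: legendre_cases.
    by case: (legendre_cases m) => ->; case: (legendre_cases n) => ->;
       rewrite ?mul0r ?mulr0 ?mulrNN ?mulr1 ?mul1r;
       (constructor 1 + constructor 2 + constructor 3).
  by rewrite intrM !legendreE natrM exprMn.
- by apply: signF_inj; rewrite ?legendreE ?(Fp_nat_mod qP) //; exact: legendre_cases.
- rewrite coprime_sym prime_coprime // /legendre.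
  by case: (q %| n)%N => //=; case: ifP => _; [left|right].
Qed.

Lemma legendre_opp1 n : (q %| n.+1)%N -> legendre q n = sgn4 q.
Proof.
move=> qn; apply: signF_inj; first exact: legendre_cases.
  by rewrite /sgn4 q_odd; case: ifP => _; [constructor 2|constructor 3].
rewrite legendreE.
have -> : n%:R = -1 :> 'F_q.
  by apply/eqP; rewrite -addr_eq0 natr1 natrF_eq0.
rewrite -signr_odd /sgn4 q_odd.
have -> : (q %% 4 == 1)%N = ~~ odd q./2 by apply/idP/idP; lia.
by case: (odd _); rewrite /= ?expr0 ?expr1 ?intrN.
Qed.

(** The unit group is cyclic of order [q - 1], so [n^((q-1)/2) = 1] makes [n] an even power of a
    generator. *)
Lemma legendre1_sqrt n : legendre q n = 1 -> exists y, y ^ 2 = n %[mod q].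
Proof.
move=> l1; have h0 : (0 < q./2)%N by have := prime_gt1 qP; lia.
have := legendreE n; rewrite l1 => /esym xh.
have x0 : (n%:R : 'F_q) \is a GRing.unit.
  rewrite unitfE; apply/eqP => x0; move: xh.
  by rewrite x0 expr0n eqn0Ngt h0 /= => /eqP; rewrite eq_sym oner_eq0.
pose u : {unit 'F_q} := FinRing.unit _ x0.
have uh : (u ^+ q./2 = 1)%g by apply: val_inj; rewrite FinRing.val_unitX.
have /cyclicP[g gE] : cyclic [set: {unit 'F_q}] by exact: field_unit_group_cyclic.
have /cycleP[i ui] : u \in <[g]>%g by rewrite -gE inE.
have og : #[g]%g = (q./2).*2.
  by rewrite orderE -gE card_finField_unit card_Fp // {1}qE.
have i2 : ~~ odd i.
  move/eqP: uh; rewrite ui -expgM -order_dvdn og -muln2.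
  by rewrite mulnC dvdn_pmul2r // dvdn2.
pose y : 'F_q := \val (g ^+ i./2)%g.
exists (y : nat).
have yE : y ^+ 2 = n%:R.
  rewrite -FinRing.val_unitX -expgM muln2.
  by have -> : (i./2).*2 = i by [rewrite -[RHS]odd_double_half (negPf i2)|]; rewrite -ui.
have := congr1 (fun x : 'F_q => x : nat) yE.
rewrite [RHS]val_Fp_nat // => <-.
have -> : y ^+ 2 = ((y : nat) ^ 2)%N%:R by rewrite natrX natr_Zp.
by rewrite val_Fp_nat // modn_mod.
Qed.

End Legendre.

(** * Gauss's lemma and Eisenstein's lattice points *)

Section GaussLemma.
Variables (q n : nat).
Hypotheses (qP : prime q) (q_odd : odd q) (nq : ~~ (q %| n)%N).

Let h := q./2.
Let r k := ((n * k) %% q)%N.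
(** The distance from [n k] to the nearest multiple of [q]. *)
Let m k := if (h < r k)%N then (q - r k)%N else r k.

Let qE : q = h.*2.+1.
Proof. by rewrite -[LHS]odd_double_half q_odd. Qed.

(** If [m x = m y], then [q] divides [x - y] or [x + y], and both are smaller than [q] in absolute
    value. *)
Lemma gauss_perm : perm_eq [seq m k | k <- index_iota 1 h.+1] (index_iota 1 h.+1).
Proof.
have q0 := prime_gt0 qP.
have rq k : (r k < q)%N by rewrite ltn_pmod.
have r0 k : (0 < k < h.+1)%N -> (0 < r k)%N.
  move=> /andP[k0 kh]; rewrite lt0n; apply/negP => /eqP rk.
  have : (q %| n * k)%N by rewrite /dvdn; apply/eqP.
  rewrite Euclid_dvdM // (negPf nq) /= => /(dvdn_leq k0); rewrite qE; lia.
have mh k : (0 < k < h.+1)%N -> (0 < m k < h.+1)%N.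
  by move=> hk; have := r0 k hk; have := rq k; rewrite /m; case: ifP; rewrite qE; lia.
have u : uniq [seq m k | k <- index_iota 1 h.+1].
  rewrite map_inj_in_uniq ?iota_uniq // => x y.
  rewrite !mem_index_iota => hx hy.
  wlog lexy : x y hx hy / (x <= y)%N => [W E|E].
    by case/orP: (leq_total x y) => ?; [|apply/esym]; apply: W.
  have : (q %| n * (y - x))%N || (q %| n * (y + x))%N.
    have [E1|E1] : r x = r y \/ (r x + r y = q)%N.
      move: E; rewrite /m; case: ifP => h1; case: ifP => h2.
      - by have := rq x; have := rq y; lia.
      - by have := rq x; lia.
      - by have := rq y; lia.
      - by left.
    - apply/orP; left; rewrite mulnBr -eqn_mod_dvd ?leq_mul2l ?lexy ?orbT //.
      by apply/eqP/esym.
    - apply/orP; right; rewrite mulnDr /dvdn -modnDm -/(r x) -/(r y) addnC E1.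
      by rewrite modnn.
  rewrite !Euclid_dvdM // (negPf nq) /= => /orP[] hd.
    have [//|xy] : x = y \/ (0 < y - x)%N by lia.
    by move/dvdn_leq: hd => /(_ xy); rewrite qE; lia.
  have xy : (0 < y + x)%N by lia.
  by move/dvdn_leq: hd => /(_ xy); rewrite qE; lia.
apply: uniq_perm => //; first exact: iota_uniq.
have [] := @uniq_min_size _ _ (index_iota 1 h.+1) u.
- by move=> x /mapP[k]; rewrite !mem_index_iota => /mh hk ->.
- by rewrite size_map.
- by [].
Qed.

Let mu := (\sum_(1 <= k < h.+1) (h < r k))%N.

(** Modulo [q] the product of the [n k] is [n^h h!]; it is also [(-1)^mu h!], since [n k] is [m k]
    up to sign and [m] permutes the factors. *)
Lemma gauss_lemma : legendre q n = (-1) ^+ odd mu.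
Proof.
apply: (signF_inj qP q_odd); [exact: legendre_cases | exact: sign_cases |].
rewrite legendreE // -/h rmorphXn rmorphN1 signr_odd.
pose w : 'F_q := \prod_(1 <= k < h.+1) k%:R.
have w0 : w != 0.
  rewrite /w big_nat; apply: (big_ind (fun x : 'F_q => x != 0)).
  - exact: oner_neq0.
  - exact: mulf_neq0.
  move=> k /andP[k0 kh].
  rewrite natrF_eq0 //; apply/negP => /(dvdn_leq k0); rewrite qE; lia.
apply: (mulIf w0).
transitivity (\prod_(1 <= k < h.+1) (n * k)%:R : 'F_q).
  under [RHS]eq_bigr do rewrite natrM.
  by rewrite big_split /= prodr_const_nat subn1.
have -> : w = \prod_(1 <= k < h.+1) (m k)%:R.
  by rewrite /w -(perm_big _ gauss_perm) big_map.
rewrite /mu (big_morph _ (exprD (-1 : 'F_q)) (expr0 _)) -big_split /=.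
apply: eq_bigr => k _; rewrite -(Fp_nat_mod qP) -/(r k) /m.
case: ifP => _; last by rewrite expr0 mul1r.
rewrite expr1 mulN1r; apply/eqP; rewrite -addr_eq0 -natrD subnKC.
  by rewrite (natrF_eq0 qP) dvdnn.
by apply/ltnW; rewrite ltn_pmod ?prime_gt0.
Qed.

Let S := (\sum_(1 <= k < h.+1) k)%N.
Let F := (\sum_(1 <= k < h.+1) (n * k) %/ q)%N.

(** Sum of [n k = q ((n k) %/ q) + r k], where [r k] is [q - m k] for [mu] values of [k] and [m k]
    for the others. It is meant to be read modulo 2. *)
Lemma eisenstein_identity :
  exists Z, (n * S + Z.*2 = q * F + S + q * mu)%N.
Proof.
exists (\sum_(1 <= k < h.+1) (h < r k) * m k)%N.
have SE : S = (\sum_(1 <= k < h.+1) m k)%N.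
  by rewrite /S -(perm_big _ gauss_perm) big_map.
rewrite {2}SE -muln2 mulnC /S /F /mu !big_distrl /= !big_distrr /= -!big_split /=.
apply: eq_bigr => k _; rewrite {1}[(k * n)%N]mulnC {1}(divn_eq (n * k) q) -/(r k).
have : (r k < q)%N by rewrite ltn_pmod ?prime_gt0.
rewrite /m (mulnC (_ %/ _)%N); move: (q * _)%N (r k) => t x.
by case: ifP => /= _; rewrite ?mul1n ?mul0n ?muln1 ?muln0; lia.
Qed.

Lemma legendre_eisenstein : odd n -> legendre q n = (-1) ^+ odd F.
Proof.
move=> n_odd; rewrite gauss_lemma; congr (_ ^+ nat_of_bool _).
have [Z /(congr1 odd)] := eisenstein_identity.
rewrite !(oddD, oddM) odd_double n_odd q_odd /= addbF.
by case: (odd S); case: (odd F); case: (odd mu).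
Qed.

(** All the quotients in [F] vanish, so [mu] has the parity of [S = h (h + 1) / 2], which [h] modulo
    4 determines. *)
Lemma legendre2 : n = 2%N -> legendre q n = sgn8 q.
Proof.
move=> n2; rewrite gauss_lemma.
have F0 : F = 0%N.
  rewrite /F big_nat big1 // => k /andP[k0 kh].
  by rewrite divn_small // n2 qE; lia.
have SE : (S.*2 = h * h.+1)%N.
  rewrite /S; elim: (h) => [|i IH]; first by rewrite big_geq.
  by rewrite big_nat_recr //= doubleD IH; lia.
have [Z] := eisenstein_identity; rewrite F0 n2 => E.
have -> : odd mu = odd S.
  move/(congr1 odd): E; rewrite !(oddD, oddM) odd_double q_odd /=.
  by case: (odd S); case: (odd mu).
rewrite /sgn8 q_odd; move: SE.
have [j [i [hE jlt]]] : exists j i, h = (4 * j + i)%N /\ (i < 4)%N.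
  by exists (h %/ 4)%N, (h %% 4)%N; rewrite mulnC -divn_eq ltn_pmod.
rewrite hE => SE.
have qE8 : (q %% 8 = (2 * i).+1 %% 8)%N by rewrite qE hE; lia.
rewrite qE8.
move: jlt SE; case: i {hE qE8} => [|[|[|[|//]]]] _ SE /=.
- have -> : S = (j * (4 * j + 1)).*2 by nia.
  by rewrite odd_double.
- have -> : S = (4 * j * j + 3 * j).*2.+1 by nia.
  by rewrite /= odd_double.
- have -> : S = (4 * j * j + 5 * j + 1).*2.+1 by nia.
  by rewrite /= odd_double.
- have -> : S = ((4 * j + 3) * j.+1).*2 by nia.
  by rewrite odd_double.
Qed.

End GaussLemma.

(** The two sums count the lattice points of a rectangle on either side of the line [l q = p k]; by
    coprimality none lies on it. *)
Lemma floor_sum_symm (p q : nat) : odd p -> odd q -> coprime p q ->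
  (\sum_(1 <= k < q./2.+1) (p * k) %/ q + \sum_(1 <= l < p./2.+1) (q * l) %/ p
     = p./2 * q./2)%N.
Proof.
move=> op oq cpq.
have fl (a b k : nat) : odd a -> odd b -> (k < b./2.+1)%N ->
    ((a * k) %/ b = \sum_(1 <= l < a./2.+1) (l * b <= a * k))%N.
  move=> oa ob kb; have b0 : (0 < b)%N by lia.
  have le : ((a * k) %/ b <= a./2)%N.
    by rewrite -ltnS ltn_divLR //; nia.
  have E : (\sum_(1 <= l < ((a * k) %/ b).+1) 1 = (a * k) %/ b)%N.
    by rewrite sum_nat_const_nat subn1 muln1.
  rewrite -{1}E (@big_nat_widen _ _ _ _ _ a./2.+1) ?ltnS // big_mkcond /=.
  by apply: eq_bigr => l _; rewrite ltnS leq_divRL //; case: (_ <= _)%N.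
have -> : (\sum_(1 <= k < q./2.+1) (p * k) %/ q =
    \sum_(1 <= k < q./2.+1) \sum_(1 <= l < p./2.+1) (l * q <= p * k))%N.
  rewrite big_nat [RHS]big_nat; apply: eq_bigr => k /andP[_ kq]; exact: fl.
have -> : (\sum_(1 <= l < p./2.+1) (q * l) %/ p =
    \sum_(1 <= l < p./2.+1) \sum_(1 <= k < q./2.+1) (k * p <= q * l))%N.
  rewrite big_nat [RHS]big_nat; apply: eq_bigr => k /andP[_ kq]; exact: fl.
rewrite [X in (_ + X)%N]exchange_big_nat -big_split /=.
rewrite (@eq_big_nat _ _ _ _ _ _ (fun=> p./2)) => [|k /andP[k0 kq]].
  by rewrite sum_nat_const_nat subn1 mulnC.
rewrite -big_split (@eq_big_nat _ _ _ _ _ _ (fun=> 1%N)) => [|l /andP[l0 lp]].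
  by rewrite sum_nat_const_nat subn1 muln1.
have : (l * q != p * k)%N.
  apply/eqP => E; have : (q %| p * k)%N by rewrite -E dvdn_mull.
  by rewrite Gauss_dvdr 1?coprime_sym // => /(dvdn_leq k0); lia.
by rewrite (mulnC k) (mulnC q); case: ltngtP.
Qed.

Lemma mod4_odd_half n : odd n -> (n %% 4 == 3)%N = odd n./2.
Proof. by move=> on; apply/idP/idP; lia. Qed.

Lemma quadratic_reciprocity p q : prime p -> prime q -> odd p -> odd q ->
  coprime p q -> legendre p q = legendre q p * rsgn p q.
Proof.
move=> pP qP po qo cpq.
have npq : ~~ (p %| q)%N by rewrite -prime_coprime.
have nqp : ~~ (q %| p)%N by rewrite -prime_coprime // coprime_sym.
rewrite (legendre_eisenstein pP po npq qo) (legendre_eisenstein qP qo nqp po).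
have := floor_sum_symm po qo cpq.
set F := (\sum_(_ <= _ < _) _)%N; set G := (\sum_(_ <= _ < _) _)%N.
move=> /(congr1 odd); rewrite oddD oddM => E.
rewrite /rsgn !mod4_odd_half //.
by move: E; case: (odd F); case: (odd G); case: (odd _); case: (odd _).
Qed.

(** * Jacobi symbols *)

Lemma sgn4M m n : sgn4 (m * n) = sgn4 m * sgn4 n.
Proof.
rewrite /sgn4 oddM -modnMm.
case: (boolP (odd m)) => om; last by rewrite mul0r.
case: (boolP (odd n)) => on; last by rewrite mulr0.
have hm : (m %% 4 = 1 \/ m %% 4 = 3)%N by lia.
have hn : (n %% 4 = 1 \/ n %% 4 = 3)%N by lia.
by case: hm => ->; case: hn => ->.
Qed.

Lemma sgn8M m n : sgn8 (m * n) = sgn8 m * sgn8 n.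
Proof.
rewrite /sgn8 oddM -modnMm.
case: (boolP (odd m)) => om; last by rewrite mul0r.
case: (boolP (odd n)) => on; last by rewrite mulr0.
have hm : (m %% 8 = 1 \/ m %% 8 = 3 \/ m %% 8 = 5 \/ m %% 8 = 7)%N by lia.
have hn : (n %% 8 = 1 \/ n %% 8 = 3 \/ n %% 8 = 5 \/ n %% 8 = 7)%N by lia.
by case: hm => [->|[->|[->|->]]]; case: hn => [->|[->|[->|->]]].
Qed.

Lemma sgn4_real_char : real_char 4 sgn4.
Proof.
split=> [m n|n|n]; first exact: sgn4M.
  by rewrite /sgn4 modn_mod; have -> : odd (n %% 4) = odd n by lia.
rewrite (@coprime_pexpr 2 n 2) // coprimen2 /sgn4.
by case: odd => //; case: ifP => _; [left|right].
Qed.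

Lemma sgn8_real_char : real_char 8 sgn8.
Proof.
split=> [m n|n|n]; first exact: sgn8M.
  by rewrite /sgn8 modn_mod; have -> : odd (n %% 8) = odd n by lia.
rewrite (@coprime_pexpr 3 n 2) // coprimen2 /sgn8.
by case: odd => //; case: ifP => _; [left|right].
Qed.

Lemma rsgnM p m n : odd m -> odd n -> rsgn p (m * n) = rsgn p m * rsgn p n.
Proof.
move=> om on; rewrite /rsgn -modnMm.
have hm : (m %% 4 = 1 \/ m %% 4 = 3)%N by lia.
have hn : (n %% 4 = 1 \/ n %% 4 = 3)%N by lia.
by case: (p %% 4 == 3)%N; case: hm => ->; case: hn => ->.
Qed.

Lemma real_char_mul_mod (R : comPzRingType) M N (f g : nat -> R) :
  real_char M f -> real_char N g -> real_char (M * N) (fun n => f n * g n).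
Proof.
move=> [fM fN f01] [gM gN g01]; split=> [m n|n|n].
- by rewrite fM gM mulrACA.
- rewrite -fN -gN modn_dvdm ?dvdn_mulr // fN.
  by rewrite modn_dvdm ?dvdn_mull // gN.
- rewrite coprimeMr; have := f01 n; have := g01 n.
  case: (coprime n M) => /=; last by move=> _ ->; rewrite mul0r.
  case: (coprime n N) => [+|-> _]; last by rewrite mulr0.
  by case=> -> [] ->; rewrite ?mulrNN ?mulr1 ?mul1r; [left|right|right|left].
Qed.

(** [J n] is the Jacobi symbol of [n] modulo [d], built as a product of Legendre symbols over the
    prime factors of [d]. The clauses give its values at -1 and at 2, and reciprocity with a
    prime. *)
Lemma jacobi_exists d : odd d -> exists J : nat -> int,
  [/\ real_char d J, forall n, (d %| n.+1)%N -> J n = sgn4 d, J 2%N = sgn8 d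
    & forall p, prime p -> odd p -> coprime p d -> legendre p d = J p * rsgn p d].
Proof.
elim/ltn_ind: d => d IH od; have [d1|d1] := leqP d 1.
  have -> : d = 1%N by lia.
  exists (fun=> 1); split=> //.
    by split=> [m n|n|n]; rewrite ?mulr1 ?coprimen1 //; left.
  move=> p pP po _; rewrite /rsgn andbF mulr1.
  exact: real_char1 (legendre_real_char pP po).
have qP := pdiv_prime d1; set q := pdiv d in qP.
have [c dE] : exists c, d = (q * c)%N.
  by exists (d %/ q)%N; rewrite mulnC divnK // pdiv_dvd.
have /andP[oq oc] : odd q && odd c by rewrite -oddM -dE.
have ltcd : (c < d)%N by have := prime_gt1 qP; rewrite dE; nia.
have [J [Jc J1 J2 Jp]] := IH c ltcd oc.
exists (fun n => legendre q n * J n); rewrite dE; split.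
- exact: real_char_mul_mod (legendre_real_char qP oq) Jc.
- move=> n dn; rewrite sgn4M; congr (_ * _).
    by apply: legendre_opp1 => //; apply: dvdn_trans dn; rewrite dvdn_mulr.
  by apply: J1; apply: dvdn_trans dn; rewrite dvdn_mull.
- rewrite J2 sgn8M; congr (_ * _); apply: legendre2 => //.
  by rewrite gtnNdvd //; have := prime_gt1 qP; lia.
- move=> p pP po; rewrite coprimeMr => /andP[cpq cpc].
  have [pM _ _] := legendre_real_char pP po; rewrite pM Jp //.
  by rewrite (quadratic_reciprocity pP qP) // rsgnM // mulrACA.
Qed.

(** * Legendre's three-square theorem *)

Lemma legendre_neg p d : prime p -> odd p ->
  legendre p d * sgn4 p = 1 -> exists y, (p %| y ^ 2 + d)%N.
Proof.
move=> pP po l1; have p0 := prime_gt0 pP.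
have [pM _ _] := legendre_real_char pP po.
have : legendre p (d * p.-1) = 1.
  by rewrite pM (legendre_opp1 pP po (n := p.-1)) // prednK.
case/(legendre1_sqrt pP po) => y yE; exists y.
by rewrite /dvdn -modnDml yE modnDml -mulnSr prednK // modnMl.
Qed.

(** That [- d] is a square modulo [e] passes to divisors of [e], and to coprime products by the
    Chinese remainder theorem. *)
Lemma residues_of_kernel d N (chi : nat -> int) a : (1 < N)%N -> real_char N chi ->
  chi a = 1 -> (forall p, prime p -> chi p = 1 -> exists y, (p %| y ^ 2 + d)%N) ->
  exists e s y, [/\ (0 < e)%N, coprime s N, e = a * s ^ 2 %[mod N]
                  & (e %| y ^ 2 + d)%N].
Proof.
move=> N1 chiN chia split_p.
have ca : coprime a N.
  apply/negPn/negP => nc; have [_ _ /(_ a)] := chiN.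
  by rewrite (negPf nc) chia => /eqP; rewrite oner_eq0.
have [] := @real_char_kernel_rep N chi N1 chiN
  (fun e => exists y, (e %| y ^ 2 + d)%N) a ca chia.
- by exists 0%N.
- move=> e p [y ey] pP cpe /(split_p p pP)[z pz].
  exists (chinese p e z y); rewrite Gauss_dvd //; apply/andP; split.
    by rewrite /dvdn -modnDml -modnXm chinese_modl // modnXm modnDml.
  by rewrite /dvdn -modnDml -modnXm chinese_modr // modnXm modnDml.
- by move=> e f fe [y ey]; exists y; exact: dvdn_trans ey.
- by move=> e [s [e0 cs eE [y ey]]]; exists e, s, y.
Qed.

Lemma sum3sq_of_dvdn (d e s y : nat) : (0 < d)%N -> (0 < e)%N -> coprime s d ->
  (d %| e + s ^ 2)%N -> (e %| y ^ 2 + d)%N -> sum_of_three_squares d%:Z.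
Proof.
move=> d0 e0 cs /dvdnP[v vE] /dvdnP[g gE].
apply: (@sum3sq_of_residues d%:Z e%:Z s%:Z y%:Z g%:Z v%:Z) => //.
- by rewrite expr2 -!PoszM mulnn mulnC -vE PoszD addrK.
- by rewrite expr2 -!PoszM mulnn mulnC -gE PoszD.
Qed.

(* The witnesses [a] are classical: [a = -1 mod d] (or [2 a = -1 mod d] when
   [d = 3 mod 8]) makes [- e] (or [- 2 e]) a square modulo [d], and the
   conditions on [d] are exactly what is needed for [chi a = 1], where [chi p]
   is the Legendre symbol of [- d] modulo [p]. *)
Lemma three_squares_odd d : odd d -> (d %% 8 != 7)%N -> sum_of_three_squares d%:Z.
Proof.
move=> od d7; have d0 : (0 < d)%N by case: d od {d7}.
have [J [Jd J1 J2 Jp]] := jacobi_exists od.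
have [d1|d3] : (d %% 4 = 1 \/ d %% 8 = 3)%N by lia.
- have chiN := real_char_mul_mod sgn4_real_char Jd.
  have chia : sgn4 (2 * d).-1 * J (2 * d).-1 = 1.
    rewrite J1; last by rewrite prednK ?muln_gt0 ?d0 // dvdn_mull.
    rewrite /sgn4 od d1 /= mulr1.
    have -> : odd (2 * d).-1 by lia.
    by have -> : ((2 * d).-1 %% 4 = 1)%N by lia.
  have [||e [s [y [e0 cs eE ey]]]] := @residues_of_kernel d _ _ _ _ chiN chia.
  + by lia.
  + move=> p pP; rewrite /sgn4; case: (boolP (odd p)) => [po|]; last by rewrite mul0r.
    move=> h; apply: legendre_neg => //; rewrite Jp //.
      by rewrite /rsgn d1 andbF mulr1 mulrC /sgn4 po.
    have [_ _ /(_ p)] := Jd; case: coprime => // J0.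
    by move: h; rewrite J0 mulr0.
  move: cs; rewrite coprimeMr => /andP[_ cs].
  apply: (sum3sq_of_dvdn d0 e0 cs _ ey).
  have dN : (d %| 4 * d)%N by rewrite dvdn_mull.
  move/(congr1 (modn^~ d)): eE; rewrite !(modn_dvdm _ dN) => eE.
  rewrite /dvdn -modnDml eE modnDml -mulSnr prednK ?muln_gt0 //.
  by rewrite -mulnA mulnCA modnMr.
(* Here [(-d / p) = (p / d)] by reciprocity; the square of [sgn4] only makes the character vanish at
   even numbers. *)
- have chiN := real_char_mul_mod sgn4_real_char (real_char_mul_mod sgn4_real_char Jd).
  have aE : (2 * d./2).+1 = d by lia.
  have chia : sgn4 d./2 * (sgn4 d./2 * J d./2) = 1.
    have -> : J d./2 = 1.
      have [JM _ _] := Jd; have := J1 (2 * d./2)%N; rewrite aE dvdnn JM J2.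
      rewrite /sgn4 /sgn8 od d3; have -> : (d %% 4 = 3)%N by lia.
      by move=> /(_ isT) /=; rewrite mulN1r => /oppr_inj.
    rewrite mulr1 /sgn4; have -> : odd d./2 by lia.
    by case: ifP.
  have [||e [s [y [e0 cs eE ey]]]] := @residues_of_kernel d _ _ _ _ chiN chia.
  + by lia.
  + move=> p pP; rewrite {1 2}/sgn4; case: (boolP (odd p)) => [po|]; last by rewrite mul0r.
    have -> : (if (p %% 4 == 1)%N then 1 else -1 : int) = sgn4 p by rewrite /sgn4 po.
    have s4 : sgn4 p * sgn4 p = 1 by rewrite /sgn4 po; case: ifP.
    rewrite mulrA s4 mul1r => h; apply: legendre_neg => //; rewrite Jp //.
      have -> : rsgn p d = sgn4 p.
        rewrite /rsgn /sgn4 po; have -> : (d %% 4 = 3)%N by lia.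
        have : (p %% 4 = 1 \/ p %% 4 = 3)%N by lia.
        by case=> ->.
      by rewrite h mul1r.
    have [_ _ /(_ p)] := Jd; case: coprime => // J0.
    by move: h; rewrite J0.
  move: (cs); rewrite !coprimeMr => /and3P[cs4 _ csd].
  have oe : odd e.
    have os : odd s by move: cs4; rewrite (@coprime_pexpr 2 s 2) // coprimen2.
    move/(congr1 (modn^~ 2)): eE; rewrite !modn_dvdm ?dvdn_mulr // !modn2 oddM oddX os.
    have -> : odd d./2 by lia.
    by case: odd.
  (* For [2 e] to divide [z^2 + d] the root must be odd; adding the odd number [e] corrects the
     parity. *)
  have [z [ez oz]] : exists z, (e %| z ^ 2 + d)%N /\ odd z.
    have [oy|ey2] := boolP (odd y); first by exists y.
    exists (y + e)%N; rewrite oddD oe (negPf ey2); split=> //.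
    have -> : ((y + e) ^ 2 + d = (y ^ 2 + d) + (2 * y + e) * e)%N by nia.
    by rewrite dvdn_addr ?dvdn_mull.
  apply: (@sum3sq_of_dvdn d (2 * e) s z) => //; first by rewrite muln_gt0.
    have dN : (d %| 4 * (4 * d))%N by rewrite mulnA dvdn_mull.
    move/(congr1 (modn^~ d)): eE; rewrite !(modn_dvdm _ dN) => eE.
    rewrite /dvdn -modnDml -modnMmr eE modnMmr modnDml mulnA -mulSnr aE.
    by rewrite modnMr.
  rewrite Gauss_dvd ?ez ?andbT ?coprime2n //.
  by rewrite dvdn2 oddD oddX oz od.
Qed.

Lemma three_squares_2odd d : odd d -> sum_of_three_squares (2 * d)%N%:Z.
Proof.
move=> od; have d0 : (0 < d)%N by case: d od.
have [J [Jd J1 J2 Jp]] := jacobi_exists od.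
(* On odd [p] this is [sgn4 p * rsgn p d], the factor that turns [(2 / p) (p / d)] into
   [(-2d / p)]. *)
pose eps p := if (d %% 4 == 1)%N then sgn4 p else sgn4 p * sgn4 p.
have epsN : real_char 4 eps.
  rewrite /eps; case: (d %% 4 == 1)%N; first exact: sgn4_real_char.
  exact: real_char_mul sgn4_real_char sgn4_real_char.
have chiN := real_char_mul_mod (real_char_mul_mod epsN sgn8_real_char) Jd.
pose a := (2 * d).-1; have aE : a.+1 = (2 * d)%N by rewrite prednK ?muln_gt0 ?d0.
have oa : odd a by lia.
have chia : eps a * sgn8 a * J a = 1.
  rewrite J1; last by rewrite aE dvdn_mull.
  rewrite /eps /sgn8 /sgn4 od oa.
  have [d1|d3] : (d %% 4 = 1 \/ d %% 4 = 3)%N by lia.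
    rewrite d1; have -> : (a %% 4 = 1)%N by lia.
    by have -> : (a %% 8 = 1)%N by lia.
  rewrite d3; have -> : (a %% 4 = 1)%N by lia.
  by have -> : (a %% 8 = 5)%N by lia.
have [||e [s [y [e0 cs eE ey]]]] := @residues_of_kernel (2 * d) _ _ _ _ chiN chia.
- by lia.
- move=> p pP; have [po h|ep] := boolP (odd p); last first.
    by rewrite /sgn8 (negPf ep) mulr0 mul0r.
  have p2 : ~~ (p %| 2)%N by rewrite gtnNdvd //; have := prime_gt1 pP; lia.
  have [pM _ _] := legendre_real_char pP po.
  have cpd : coprime p d.
    have [_ _ /(_ p)] := Jd; case: coprime => // J0.
    by move: h; rewrite J0 mulr0.
  apply: legendre_neg => //; rewrite pM (legendre2 pP po p2) // Jp //.
  rewrite -[RHS]h; have -> : eps p = sgn4 p * rsgn p d; last by ring.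
  rewrite /eps /rsgn.
  have [d1|d3] : (d %% 4 = 1 \/ d %% 4 = 3)%N by lia.
    by rewrite d1 andbF mulr1.
  rewrite d3 /= andbT; congr (_ * _); rewrite /sgn4 po.
  have : (p %% 4 = 1 \/ p %% 4 = 3)%N by lia.
  by case=> ->.
move: cs; rewrite !coprimeMr => /andP[/andP[cs4 cs8] csd].
have cs2 : coprime s (2 * d).
  by rewrite coprimeMr csd andbT; move: cs4; rewrite (@coprime_pexpr 2 s 2).
have d20 : (0 < 2 * d)%N by rewrite muln_gt0.
apply: (sum3sq_of_dvdn d20 e0 cs2 _ ey).
have dN : (2 * d %| 4 * 8 * d)%N by rewrite dvdn_mul.
move/(congr1 (modn^~ (2 * d)%N)): eE; rewrite !(modn_dvdm _ dN) => eE.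
by rewrite /dvdn -modnDml eE modnDml -mulSnr aE modnMr.
Qed.

(** * Powers of 4, the obstruction modulo 8, and the criterion *)

Lemma sum3sq_scale (c m : int) :
  sum_of_three_squares m -> sum_of_three_squares (c ^+ 2 * m).
Proof. by move=> [x [y [z ->]]]; exists (c * x), (c * y), (c * z); ring. Qed.

Lemma sqr_mod8 (x : int) :
  (exists t, x = 2 * t) \/ (exists t, x ^+ 2 = 8 * t + 1).
Proof.
have [q [xE|xE]] : exists q, x = 2 * q \/ x = 2 * q + 1.
  by exists (x %/ 2)%Z; have := divz_eq x 2; lia.
- by left; exists q.
- right; have [t [tE|tE]] : exists t, q = 2 * t \/ q = 2 * t + 1.
    by exists (q %/ 2)%Z; have := divz_eq q 2; lia.
  + by exists (t * (2 * t + 1)); rewrite xE tE; ring.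
  + by exists ((2 * t + 1) * (t + 1)); rewrite xE tE; ring.
Qed.

Lemma sum3sq_div4 (m : int) : sum_of_three_squares (4 * m) -> sum_of_three_squares m.
Proof.
move=> [x [y [z E]]].
have [[x' xE]|[x' xE]] := sqr_mod8 x; have [[y' yE]|[y' yE]] := sqr_mod8 y;
have [[z' zE]|[z' zE]] := sqr_mod8 z;
  move: E; rewrite ?xE ?yE ?zE ?exprMn => E; try lia.
exists x', y', z'; apply: (mulfI (x := 4)) => //; rewrite E; ring.
Qed.

Lemma sum3sq_mod8_neq7 (m t : int) : m = 8 * t + 7 -> ~ sum_of_three_squares m.
Proof.
move=> mE [x [y [z E]]].
have [[x' xE]|[x' xE]] := sqr_mod8 x; have [[y' yE]|[y' yE]] := sqr_mod8 y;
have [[z' zE]|[z' zE]] := sqr_mod8 z;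
  move: E; rewrite ?xE ?yE ?zE ?exprMn mE => E; lia.
Qed.

Theorem legendre_three_squares v w : odd w ->
  sum_of_three_squares (2 ^ v * w)%N%:Z <-> ~~ (~~ odd v && (w %% 8 == 7)%N).
Proof.
move=> ow; split.
  move=> s3; apply/negP => /andP[ev /eqP w7].
  move: s3; rewrite -(odd_double_half v) (negPf ev) add0n -mul2n expnM.
  elim: (v./2) => [|n IH].
    rewrite mul1n; apply: (@sum3sq_mod8_neq7 _ (w %/ 8)%:Z).
    by rewrite {1}(divn_eq w 8) w7; lia.
  by rewrite expnS -mulnA PoszM => /sum3sq_div4.
move=> h.
have -> : (2 ^ v * w)%N%:Z = (2 ^ v./2)%N%:Z ^+ 2 * (2 ^ odd v * w)%N%:Z.
  rewrite expr2 -!PoszM mulnA -!expnD; congr (Posz (2 ^ _ * w)).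
  by rewrite -[LHS]odd_double_half -addnn addnC.
apply: sum3sq_scale; move: h; case: (odd v) => h; first exact: three_squares_2odd.
by rewrite mul1n; apply: three_squares_odd.
Qed.

(** * The automaton of factorials *)

Definition state : Type := (bool * nat * nat)%type.

(* [(2y + b)! = 2^y * y! * (1 * 3 * ... * (2y - 1)) * (2y + 1)^b], and modulo 8
   the product of the first [y] odd numbers only depends on [y] modulo 4. *)
Definition next (b : bool) (s : state) : state :=
  let: (e, u, r) := s in
  (e (+) odd r, (u * nth 0 [:: 1; 1; 3; 7] r * (if b then r.*2.+1 else 1)) %% 8,
   (r.*2 + b) %% 4)%N.

Definition accepting (s : state) : bool :=
  let: (e, u, _) := s in ~~ e && (u == 7)%N.

Definition fact_state (x : nat) (s : state) : Prop :=
  let: (e, u, r) := s in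
  exists v w, [/\ x`! = (2 ^ v * w)%N, odd w, odd v = e, (w %% 8)%N = u
                & (x %% 4)%N = r].

(** Four consecutive odd numbers have product [1 * 3 * 5 * 7 = 105], which is 1 modulo 8. *)
Lemma odd_prod_mod8 y :
  ((\prod_(0 <= i < y) i.*2.+1) %% 8 = nth 0 [:: 1; 1; 3; 7] (y %% 4))%N.
Proof.
elim: y => [|y IH]; first by rewrite big_geq.
rewrite big_nat_recr //= -modnMml IH.
have := divn_eq y 4; have := ltn_pmod y (isT : 0 < 4)%N.
move: (y %/ 4)%N (y %% 4)%N => t [|[|[|[|//]]]] _ ->; rewrite -modnMmr.
- have -> : ((t * 4 + 0).*2.+1 %% 8 = 1)%N by lia.
  by have -> : ((t * 4 + 0).+1 %% 4 = 1)%N by lia.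
- have -> : ((t * 4 + 1).*2.+1 %% 8 = 3)%N by lia.
  by have -> : ((t * 4 + 1).+1 %% 4 = 2)%N by lia.
- have -> : ((t * 4 + 2).*2.+1 %% 8 = 5)%N by lia.
  by have -> : ((t * 4 + 2).+1 %% 4 = 3)%N by lia.
- have -> : ((t * 4 + 3).*2.+1 %% 8 = 7)%N by lia.
  by have -> : ((t * 4 + 3).+1 %% 4 = 0)%N by lia.
Qed.

Lemma fact_double y :
  ((y.*2)`! = 2 ^ y * y`! * \prod_(0 <= i < y) i.*2.+1)%N.
Proof.
elim: y => [|y IH]; first by rewrite big_geq.
rewrite doubleS !factS IH big_nat_recr //= expnS.
by move: (\prod_(_ <= _ < _) _)%N (2 ^ y)%N (y`!) => a b c; lia.
Qed.

Lemma odd_prod_odd y : odd (\prod_(0 <= i < y) i.*2.+1)%N.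
Proof.
elim: y => [|y IH]; first by rewrite big_geq.
by rewrite big_nat_recr //= oddM IH /= odd_double.
Qed.

Lemma fact_state_next y (b : bool) s : fact_state y s -> fact_state (y.*2 + b) (next b s).
Proof.
case: s => [[e u] r] /= [v [w [yE ow ve wu yr]]].
pose o := (\prod_(0 <= i < y) i.*2.+1)%N.
exists (v + y)%N, (w * o * (if b then y.*2.+1 else 1))%N; split.
- have := fact_double y; rewrite yE -/o => dE.
  case: b; rewrite ?addn1 ?addn0 ?factS dE expnD ?muln1; last lia.
  by move: (2 ^ v)%N (2 ^ y)%N => a c; lia.
- by rewrite !oddM ow odd_prod_odd; case: b => //=; rewrite odd_double.
- by rewrite oddD ve -yr; congr (_ (+) _); lia.
- rewrite -modnMm -(modnMm w) wu odd_prod_mod8 yr modnMml modnMmr.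
  case: b => //; rewrite -(modnMmr _ y.*2.+1) -(modnMmr _ r.*2.+1) -yr.
  by congr (_ * _ %% 8)%N; lia.
- by rewrite -yr; lia.
Qed.

Definition nonrep (x : nat) : bool := `[< ~ sum_of_three_squares (x`!)%:Z >].

Lemma nonrep_accepting x s : fact_state x s -> nonrep x = accepting s.
Proof.
case: s => [[e u] r] /= [v [w [xE ow <- <- _]]]; rewrite /nonrep xE.
apply/asboolP/idP => [h|h].
  by apply/negPn/negP => h1; apply: h; apply/legendre_three_squares.
by move/(legendre_three_squares v ow); rewrite h.
Qed.

(** The number of accepted words of [k] digits read from [s], most significant digit first; binary
    integers keep the tables computable. *)
Fixpoint acc (k : nat) (s : state) : N :=
  if k is k'.+1 then (acc k' (next false s) + acc k' (next true s))%num
  else if accepting s then 1%num else 0%num.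

Lemma accS k s : acc k.+1 s = (acc k (next false s) + acc k (next true s))%num.
Proof. by []. Qed.

Lemma sum_nonrep_acc k y s : fact_state y s ->
  (\sum_(0 <= i < 2 ^ k) nonrep (y * 2 ^ k + i))%N = N.to_nat (acc k s).
Proof.
elim: k y s => [|k IH] y s ys.
  by rewrite expn0 big_nat1 muln1 addn0 (nonrep_accepting ys) /=; case: ifP.
rewrite expnS mul2n -addnn (@big_cat_nat _ _ _ (2 ^ k)) ?leq_addr //=.
rewrite Nnat.N2Nat.inj_add -(IH (y.*2 + false)%N); last exact: fact_state_next.
rewrite -(IH (y.*2 + true)%N); last exact: fact_state_next.
congr (_ + _)%N.
  by apply: eq_bigr => i _; congr (nat_of_bool (nonrep _)); lia.
rewrite -{1}[(2 ^ k)%N]add0n big_addn addnK.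
by apply: eq_bigr => i _; congr (nat_of_bool (nonrep _)); lia.
Qed.

Lemma fact_state0 : fact_state 0 (false, 1%N, 0%N).
Proof. by exists 0%N, 1%N. Qed.

(** [4! = 2^3 * 3], and [next false] fixes this state. *)
Lemma fact_state_pow2 k : (2 <= k)%N -> fact_state (2 ^ k) (true, 3%N, 0%N).
Proof.
move=> k2; rewrite -(subnK k2); elim: (k - 2)%N => [|n IH].
  by exists 3%N, 3%N.
by have := fact_state_next false IH; rewrite addn0 -mul2n -expnS.
Qed.

(** [acc] counts over [0 <= x < 2^k] and [Sbar] over [1 <= x <= 2^k]; neither 0 nor [2^k]
    contributes. *)
Lemma Sbar_pow2 k : (2 <= k)%N -> Sbar (2 ^ k) = N.to_nat (acc k (false, 1%N, 0%N)).
Proof.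
move=> k2; rewrite -(sum_nonrep_acc k fact_state0) /Sbar -sum1_card big_mkcond /=.
have z : nat_of_bool (nonrep (2 ^ k)) = 0%N.
  by rewrite (nonrep_accepting (fact_state_pow2 k2)).
rewrite -[RHS]addn0 -[X in _ = (_ + X)%N]z big_mkord big_ord_recr /= inE /= expn_gt0 /=.
congr (_ + _)%N.
apply: eq_bigr => i _; rewrite inE /= mul0n add0n.
case: (nat_of_ord i) => [|n] /=; last by rewrite /nonrep; case: asbool.
by rewrite (nonrep_accepting fact_state0).
Qed.

(** * The transfer matrix and the closed form *)

Definition states : seq state :=
  [seq (eu, r) | eu <- [seq (e, u) | e <- [:: false; true], u <- [:: 1; 3; 5; 7]%N],
                 r <- iota 0 4].

(** The transfer matrix applied to the vector of all 32 counts, which avoids the exponential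
    recursion of [acc]. *)
Definition tab_step (t : seq N) : seq N :=
  [seq (nth 0%num t (index (next false s) states) +
        nth 0%num t (index (next true s) states))%num | s <- states].

Definition tab (k : nat) : seq N := iter k tab_step [seq acc 0 s | s <- states].

Lemma next_states b s : s \in states -> next b s \in states.
Proof.
have /allP h : all (fun s => all (fun b => next b s \in states) [:: false; true]) states.
  by vm_compute.
by move=> /h /allP; apply; case: b.
Qed.

Lemma acc_tab k s : s \in states -> acc k s = nth 0%num (tab k) (index s states).
Proof.
elim: k s => [|k IH] s sS.
  by rewrite (nth_map s) ?index_mem // nth_index.
rewrite /tab iterS -/(tab k) (nth_map s) ?index_mem // nth_index //=.
by rewrite !IH ?next_states.
Qed.

(* The component of [acc k] along the eigenvalue 2 of the transfer matrix is
   [2 ^ k / 8], and from [k = 2] on, 24 steps multiply the rest by [2 ^ 12]; by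
   linearity it suffices to check the 32 states at [k = 2]. *)
Lemma acc_period k s : (2 <= k)%N -> s \in states ->
  (8 * acc (24 + k) s = 2 ^ 15 * acc k s + (2 ^ 24 - 2 ^ 12) * 2 ^ N.of_nat k)%num.
Proof.
move=> k2; rewrite -(subnKC k2); elim: (k - 2)%N s => [|n IH] s sS.
  rewrite !acc_tab //.
  have /allP/(_ s sS)/N.eqb_spec // : all (fun s =>
    (8 * nth 0 (tab (24 + (2 + 0))) (index s states) =?
     2 ^ 15 * nth 0 (tab (2 + 0)) (index s states) +
     (2 ^ 24 - 2 ^ 12) * 2 ^ N.of_nat (2 + 0))%num) states.
  by vm_compute.
rewrite 2!addnS.
have h0 := IH _ (next_states false sS); have h1 := IH _ (next_states true sS).
have -> : (2 ^ N.of_nat (2 + n).+1 = 2 * 2 ^ N.of_nat (2 + n))%num.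
  by rewrite Nnat.Nat2N.inj_succ N.pow_succ_r'.
rewrite (accS (24 + (2 + n))) (accS (2 + n)).
move: h0 h1; generalize (2 ^ N.of_nat (2 + n))%num.
generalize (acc (24 + (2 + n)) (next false s)) (acc (24 + (2 + n)) (next true s)).
generalize (acc (2 + n) (next false s)) (acc (2 + n) (next true s)).
by move=> a b c d e; clear; lia.
Qed.

(* 6 plus the coefficient of [2 ^ (k / 2)] in [8 * Sbar (2 ^ k) - 2 ^ k]. *)
Definition coef (m : nat) : nat :=
  (nth 6 [:: 4; 2; 4; 2; 6; 6; 6; 6; 6; 6; 6; 4; 6; 6; 8; 6; 8; 10; 8; 6; 6; 6; 4; 0] m)%N.

(** The values [2 <= k < 26] meet every residue modulo 24 and are computed; [acc_period] does the
    rest. The constant 6 on the left avoids subtraction in [N]. *)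
Lemma acc_closed k : (2 <= k)%N ->
  (8 * acc k (false, 1%nat, 0%nat) + 6 * 2 ^ N.of_nat k./2 =
   2 ^ N.of_nat k + N.of_nat (coef (k %% 24)) * 2 ^ N.of_nat k./2)%num.
Proof.
elim/ltn_ind: k => k IH k2; have [lt26|ge26] := ltnP k 26.
  rewrite acc_tab //.
  have /allP/(_ k) : all (fun k =>
    (8 * nth 0 (tab k) (index (false, 1%nat, 0%nat) states) + 6 * 2 ^ N.of_nat k./2 =?
     2 ^ N.of_nat k + N.of_nat (coef (k %% 24)) * 2 ^ N.of_nat k./2)%num) (iota 2 24).
    by vm_compute.
  by rewrite mem_iota k2 lt26 => /(_ isT)/N.eqb_spec.
have [j kE] : exists j, k = (24 + j)%N by exists (k - 24)%N; lia.
have j2 : (2 <= j)%N by lia.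
have := IH j; have := acc_period j2 (isT : (false, 1%nat, 0%nat) \in states).
rewrite kE modnDl (_ : (24 + j)./2 = 12 + j./2)%N; last by lia.
rewrite !Nnat.Nat2N.inj_add !N.pow_add_r.
move: (2 ^ N.of_nat j)%num (2 ^ N.of_nat j./2)%num (acc _ _) (acc _ _) => a b c d.
move=> h1 /(_ _ j2) h2; have {}h2 := h2 ltac:(lia).
rewrite -[N.of_nat 24]/(24%num) -[N.of_nat 12]/(12%num).
move: h2; move: (N.of_nat (coef _)) => t h2.
have -> : (t * (2 ^ 12 * b) = 2 ^ 12 * (t * b))%num by lia.
by move: (t * b)%num h2 => tb h2; lia.
Qed.

Lemma Natpow_expn a n : Nat.pow a n = (a ^ n)%N.
Proof. by elim: n => //= n ->; rewrite expnS. Qed.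

Lemma Sbar_closed k : (2 <= k)%N ->
  8 * (Sbar (2 ^ k))%:R + 6 * 2 ^+ k./2 =
  2 ^+ k + (coef (k %% 24))%:R * 2 ^+ k./2 :> rat.
Proof.
move=> hk; have := congr1 N.to_nat (acc_closed hk).
rewrite Sbar_pow2 // !(Nnat.N2Nat.inj_add, Nnat.N2Nat.inj_mul, Nnat.N2Nat.inj_pow).
rewrite !Nnat.Nat2N.id.
move: (N.to_nat (acc _ _)) (coef _) => c t; rewrite !Natpow_expn.
rewrite -[N.to_nat 8]/8%N -[N.to_nat 6]/6%N -[N.to_nat 2]/2%N !(plusE, multE) => E.
have := congr1 (fun n : nat => n%:R : rat) E.
by rewrite !natrD !natrM !natrX => <-; ring.
Qed.

Lemma exp2z_sub (n m : nat) : (2 : rat) ^ (n%:Z - m%:Z) = 2 ^+ n / 2 ^+ m.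
Proof. by rewrite expfzDr ?pnatr_eq0 // exprnN. Qed.

(* The equation is in rat because the exponents can be negative (k = 2); in
   each case where (k - c) / 2 occurs, the residue of k makes k - c even. *)
Theorem theorem3 (k : nat) (hk : (2 <= k)%N) :
  (Sbar (2 ^ k))%:R =
    (if (k %% 24 \in [:: 0; 2; 22])%N then
       2 ^ (k%:Z - 3) - 2 ^ ((k%:Z - 4) %/ 2)%Z
     else if (k %% 24 \in [:: 1; 3])%N then
       2 ^ (k%:Z - 3) - 2 ^ ((k%:Z - 3) %/ 2)%Z
     else if (k %% 24 == 11)%N then
       2 ^ (k%:Z - 3) - 2 ^ ((k%:Z - 5) %/ 2)%Z
     else if (k %% 24 \in [:: 14; 16; 18])%N then
       2 ^ (k%:Z - 3) + 2 ^ ((k%:Z - 4) %/ 2)%Z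
     else if (k %% 24 == 17)%N then
       2 ^ (k%:Z - 3) + 2 ^ ((k%:Z - 3) %/ 2)%Z
     else if (k %% 24 == 23)%N then
       2 ^ (k%:Z - 3) - 3 * 2 ^ ((k%:Z - 5) %/ 2)%Z
     else
       2 ^ (k%:Z - 3)) :> rat.
Proof.
have := Sbar_closed hk; move: (Sbar _)%:R => c.
have E4 : ((k%:Z - 4) %/ 2)%Z = k./2%:Z - 2%:Z by lia.
have E3 : odd k -> ((k%:Z - 3) %/ 2)%Z = k./2%:Z - 1%:Z by lia.
have E5 : odd k -> ((k%:Z - 5) %/ 2)%Z = k./2%:Z - 2%:Z by lia.
have ok : odd k = odd (k %% 24) by lia.
rewrite E4 (exp2z_sub k 3) (exp2z_sub _ 2).
move: E3 E5 (ltn_pmod k (isT : 0 < 24)%N); rewrite ok.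
move: (k %% 24)%N => m E3 E5 lt24.
move: E3 E5; set x := 2 ^+ k; set y := 2 ^+ k./2 => E3 E5.
have x8 : x / 2 ^+ 3 = x / 8 by congr (_ / _).
have y4 : y / 2 ^+ 2 = y / 4 by congr (_ / _).
have {}E3 : odd m -> (2 : rat) ^ ((k%:Z - 3) %/ 2)%Z = y / 2.
  by move/E3 ->; rewrite exp2z_sub.
have {}E5 : odd m -> (2 : rat) ^ ((k%:Z - 5) %/ 2)%Z = y / 4.
  by move/E5 ->; rewrite exp2z_sub.
rewrite x8 y4.
move: x y E3 E5 {x8 y4 E4 ok} => x y.
(* For each residue the claim is linear in [x = 2^k] and [y = 2^(k./2)]. *)
do 24![case: m lt24 => [|m] lt24; [move=> E3 E5; rewrite /coef /= ?E3 ?E5 // => h; lra|]].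
by [].
Qed.
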